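(* Let $n\ge2k$, $\mathbf A_k\in\{\mathbf{TL}_k(n),\mathbf M_k(n),\mathbf{PR}_k\}$, $\lambda=[n-m,m]\in\Lambda^{\mathbf A_k}_n$, and let $r,s\ge0$ with $r+2s=k$ (for $\mathbf{TL}_k(n)$) or $r+s=k$ (otherwise). Then $\chi^\lambda_{\mathbf A_k}(\mathbf 1_r\otimes e^{\otimes s})=\mathsf F^{m,r}_{\mathbf A_k}$, where (a) $\mathsf F^{m,r}_{\mathbf{TL}_k(n)}=\binom{r}{\frac{r-m}{2}}-\binom{r}{\frac{r-m}{2}-1}$; (b) $\mathsf F^{m,r}_{\mathbf M_k(n)}=\sum_{t\ge0}\binom{r}{m+2t}\left(\binom{m+2t}{t}-\binom{m+2t}{t-1}\right)$; (c) $\mathsf F^{m,r}_{\mathbf{PR}_k}=\binom{r}{m}$.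
   Context: $\mathcal P_k$: set partitions of $\{1,\dots,k,1',\dots,k'\}$ (blocks), top row $1..k$, bottom row $1'..k'$; $\mathbf P_k(n)$ has basis $\mathcal P_k$ and product $d_1d_2=n^{\ell(d_1,d_2)}d_1\circ d_2$ (concatenation discarding $\ell$ components lying in the middle). Planar = drawable without crossings inside the rectangle of vertices. $\mathbf{TL}_k(n)$, $\mathbf M_k(n)$, $\mathbf{PR}_k$ are spanned by the planar diagrams all of whose blocks have size 2; size 1 or 2; resp. at most one vertex in each row. $\Lambda^{\mathbf A_k}_n=\{[n-m,m]:0\le m\le k\}$ for $\mathbf M_k,\mathbf{PR}_k$, and with $m\equiv k\bmod 2$ for $\mathbf{TL}_k$. The irreducible module $\mathbf A^\lambda_k$ has basis the symmetric $m$-diagrams in the algebra (a symmetric $m$-diagram is given by a set partition of $\{1..k\}$ with $m$ distinguished blocks $B$, and has blocks $B\cup B'$ for these and $B,B'$ otherwise), with action $d\cdot w=n^{\ell(d,w)}d\circ w\circ d^T$ if this has $m$ propagating blocks, else $0$ ($d^T$ = reflection); $\chi^\lambda_{\mathbf A_k}$ is its character. $\mathbf 1_r$ is the identity diagram in $\mathcal P_r$; $\otimes$ juxtaposes diagrams; $e=\frac1n\mathfrak e_1$ (blocks $\{1,2\},\{1',2'\}$) for $\mathbf{TL}_k$ and $e=\frac1n\mathfrak p_1$ (blocks $\{1\},\{1'\}$) otherwise. Binomial coefficients with negative or too large lower index are $0$. *)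

(* Defs.v *)
From HB Require Import structures.
From mathcomp Require Import all_boot all_order all_algebra.
Set Implicit Arguments. Unset Strict Implicit. Unset Printing Implicit Defensive.
Import Order.TTheory GRing.Theory Num.Theory.

(* Partition diagrams.  Vertices of a k-diagram: inl i = top vertex i+1,
   inr i = bottom vertex (i+1)'.  A diagram is a set of blocks
   (a set partition of the 2k vertices, checked by [partition d setT]). *)
Definition V (k : nat) : finType := ('I_k + 'I_k)%type.
Definition diagram (k : nat) := {set {set V k}}.

Definition is_diagram k (d : diagram k) := partition d [set: V k].

Definition swapV k (v : V k) : V k :=
  match v with inl i => inr i | inr i => inl i end.
Definition transp k (d : diagram k) : diagram k := [set (@swapV k) @: B | B : {set V k} in d].

(* Concatenation d1 o d2: bottom row of d1 glued to top row of d2.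
   Stacked vertex set: level 0 = top of d1, 1 = middle, 2 = bottom of d2. *)
Definition W (k : nat) : finType := ('I_3 * 'I_k)%type.
Definition lev0 : 'I_3 := @Ordinal 3 0 isT.
Definition lev1 : 'I_3 := @Ordinal 3 1 isT.
Definition lev2 : 'I_3 := @Ordinal 3 2 isT.
Definition emb1 k (v : V k) : W k :=
  match v with inl i => (lev0, i) | inr i => (lev1, i) end.
Definition emb2 k (v : V k) : W k :=
  match v with inl i => (lev1, i) | inr i => (lev2, i) end.
Definition embO k (v : V k) : W k :=
  match v with inl i => (lev0, i) | inr i => (lev2, i) end.
Definition stackrel k (d1 d2 : diagram k) : rel (W k) :=
  fun x y =>
    [exists B : {set V k} in d1, (x \in (@emb1 k) @: B) && (y \in (@emb1 k) @: B)] ||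
    [exists B : {set V k} in d2, (x \in (@emb2 k) @: B) && (y \in (@emb2 k) @: B)].

Definition compose k (d1 d2 : diagram k) : diagram k :=
  [set [set v | connect (stackrel d1 d2) (@embO k u) (@embO k v)] | u : V k].

Definition ell k (d1 d2 : diagram k) : nat :=
  #|[set [set y | connect (stackrel d1 d2) x y] |
      x in [set x : W k | (x.1 == lev1) &&
             [forall y, connect (stackrel d1 d2) x y ==> (y.1 == lev1)]]]|.

Definition nprop k (d : diagram k) : nat :=
  #|[set B in d | [exists i, inl i \in B] && [exists j, inr j \in B]]|.

Definition liftL a b (v : V a) : V (a + b) :=
  match v with inl i => inl (lshift b i) | inr i => inr (lshift b i) end.
Definition liftR a b (v : V b) : V (a + b) :=
  match v with inl i => inl (rshift a i) | inr i => inr (rshift a i) end.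
Definition tensor a b (d1 : diagram a) (d2 : diagram b) : diagram (a + b) :=
  [set (@liftL a b) @: B | B : {set V a} in d1] :|: [set (@liftR a b) @: B | B : {set V b} in d2].

Definition castV a b (E : a = b) (v : V a) : V b :=
  match v with inl i => inl (cast_ord E i) | inr i => inr (cast_ord E i) end.
Definition castD a b (E : a = b) (d : diagram a) : diagram b :=
  [set (@castV a b E) @: B | B : {set V a} in d].

Definition idD r : diagram r := [set [set (inl i : V r); inr i] | i : 'I_r].
Definition frakE : diagram 2 :=
  [set [set (inl ord0 : V 2); inl ord_max]; [set (inr ord0 : V 2); inr ord_max]].
Definition frakP : diagram 1 := [set [set (inl ord0 : V 1)]; [set (inr ord0 : V 1)]].
Definition emptyD : diagram 0 := set0.

(* Planarity: the partition is non-crossing w.r.t. the cyclic boundary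
   order 1,...,k,k',...,1' of the rectangle. *)
Definition pos k (v : V k) : nat :=
  match v with inl i => val i | inr i => (2 * k).-1 - val i end.
Definition planar k (d : diagram k) : bool :=
  [forall B in d, forall C in d, (B != C) ==>
     ~~ [exists a in B, exists c in B, exists b in C, exists e in C,
          (pos a < pos b) && (pos b < pos c) && (pos c < pos e)]].

Inductive Alg := TL | Motz | PRook.

Definition blockcond (A : Alg) k (d : diagram k) : bool :=
  match A with
  | TL => [forall B in d, #|B| == 2]
  | Motz => [forall B in d, (#|B| == 1) || (#|B| == 2)]
  | PRook => [forall B in d, (#|[set i | (inl i : V k) \in B]| <= 1) &&
                             (#|[set j | (inr j : V k) \in B]| <= 1)]
  end.

Definition inAlg (A : Alg) k (d : diagram k) : bool :=
  [&& is_diagram d, planar d & blockcond A d].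

(* Lambda^{A_k}_n = {[n-m,m] : 0 <= m <= k} (with m = k mod 2 for TL);
   the weight [n-m,m] is recorded by m. *)
Definition inLambda (A : Alg) (k m : nat) : bool :=
  (m <= k) && (if A is TL then odd m == odd k else true).

Definition topB k (B : {set 'I_k}) : {set V k} := [set (inl i : V k) | i in B].
Definition botB k (B : {set 'I_k}) : {set V k} := [set (inr i : V k) | i in B].
Definition symm_mdiag k (m : nat) (d : diagram k) : bool :=
  [exists Q : {set {set 'I_k}}, exists D : {set {set 'I_k}},
    [&& partition Q [set: 'I_k], D \subset Q, #|D| == m &
      d == [set topB B :|: botB B | B in D] :|:
           [set topB B | B in Q :\: D] :|: [set botB B | B in Q :\: D]]].

Definition modBasis (A : Alg) k m : {set diagram k} :=
  [set w : diagram k | symm_mdiag m w && inAlg A w].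

(* Trace of the action of a diagram d on A_k^lambda:
   d . w = n^{l(d,w)} d o w o d^T if this has m propagating blocks, else 0. *)
Definition trD (n : nat) (A : Alg) k m (d : diagram k) : rat :=
  \sum_(w in modBasis A k m)
    ((n%:R : rat) ^+ ell d w *
     ((compose (compose d w) (transp d) == w) &&
      (nprop (compose (compose d w) (transp d)) == m))%:R)%R.

(* Elements of the algebra as formal linear combinations of diagrams. *)
Definition element k := seq (rat * diagram k).
Definition chi (n : nat) (A : Alg) k m (x : element k) : rat :=
  (\sum_(p <- x) p.1 * trD n A m p.2)%R.

Definition tensorE a b (x : element a) (y : element b) : element (a + b) :=
  [seq ((p.1 * q.1)%R, tensor p.2 q.2) | p <- x, q <- y].
Definition castE a b (E : a = b) (x : element a) : element b :=
  [seq (p.1, castD E p.2) | p <- x].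
Definition idE r : element r := [:: (1%R, idD r)].

Definition cA (A : Alg) : nat := if A is TL then 2 else 1.
Definition genE (n : nat) (A : Alg) : element (cA A) :=
  match A return element (cA A) with
  | TL => [:: (((n%:R : rat)^-1)%R, frakE)]
  | Motz => [:: (((n%:R : rat)^-1)%R, frakP)]
  | PRook => [:: (((n%:R : rat)^-1)%R, frakP)]
  end.

Fixpoint powE c (x : element c) (s : nat) : element (s * c) :=
  match s return element (s * c) with
  | 0 => [:: (1%R, emptyD)]
  | s'.+1 => castE (esym (mulSnr s' c)) (tensorE (powE x s') x)
  end.

Definition binZ (r : nat) (j : int) : int :=
  if (j < 0)%R then 0%R else Posz 'C(r, `|j|%N).

Definition Fval (A : Alg) (m r : nat) : int :=
  match A with
  | TL => let j := ((Posz r - Posz m)%R %/ 2)%Z in (binZ r j - binZ r (j - 1))%R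
  | Motz => (\sum_(t < r.+1)
               binZ r (Posz (m + 2 * t)) *
               (binZ (m + 2 * t) (Posz t) - binZ (m + 2 * t) (Posz t - 1)))%R
  | PRook => Posz 'C(r, m)
  end.

(* Main.v *)
Require Import Defs.
From HB Require Import structures.
From mathcomp Require Import all_boot all_order all_algebra.
From mathcomp Require Import zify ring.
Set Implicit Arguments. Unset Strict Implicit. Unset Printing Implicit Defensive.
Import Order.TTheory GRing.Theory Num.Theory.

(** The diagram [d] underlying [1_r (x) e^(x)s] has [r] vertical strands followed
    by [s] non-propagating blocks (caps or isolated points) in each row.  The top
    blocks of [d] survive in [d o w o d^T], so this product can equal [w] only if
    [w] already contains them; conversely, every symmetric [w] containing them is
    fixed, and exactly [s] components are discarded.  The factor [n^s] cancels
    [(1/n)^s], hence the character counts the noncrossing half-diagrams with [m]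
    defects on the first [r] points.  Sorting these by their last point (defect,
    isolated point, or right end of an arc, whose left end is then turned into a
    defect) gives the recursion of lattice paths ending at height [m], which the
    three formulas also satisfy. *)

(** Deleting the last point from a half-diagram would change the ground type at every step of the
    recursion. The ground set is therefore kept equal to ['I_k]: a half-diagram is an involution of
    all of ['I_k] together with a set of defects, and from [r] on it copies an involution [sigma],
    which encodes the blocks contributed by the factors [e]. The recursion lowers [r] alone; the
    former last point becomes an idle fixed point, which is consistent because [sigma] fixes
    everything below the initial threshold [r0]. One encoding serves the three algebras: by the
    block conditions a propagating block of a symmetric diagram has a single point in each row, and
    every other block has at most two points, so it is an arc or a fixed point of an involution. In
    the trace only the diagonal entries are needed, and the exponent of [n] is the same for all
    fixed [w], so it factors out of the sum. *)

(** * Lattice path numbers and their closed forms *)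

Definition not_TL (A : Alg) : bool := if A is TL then false else true.
Definition not_PRook (A : Alg) : bool := if A is PRook then false else true.

(** Paths of [r] steps from height 0 to height [m] staying at height at least 0, split by the last
    step: up, level (absent for [TL]) or down (absent for [PRook]). *)
Fixpoint path_count (A : Alg) (r m : nat) : nat :=
  if r is r'.+1 then
    (if m is m'.+1 then path_count A r' m' else 0)
    + not_TL A * path_count A r' m + not_PRook A * path_count A r' m.+1
  else m == 0.

(** The reflection formula for paths of [M] up and down steps, [t] of them down, that stay at height
    at least 0. Working in [int] lets it take meaningful values past the middle too. *)
Definition ballot (M t : nat) : int :=
  (Posz 'C(M, t) - (if t is t'.+1 then Posz 'C(M, t') else 0))%R.

Lemma ballotS M t : ballot M.+1 t.+1 = (ballot M t.+1 + ballot M t)%R.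
Proof. by case: t => [|t]; rewrite /ballot !binS ?bin0; lia. Qed.

Lemma ballot0 M : ballot M 0 = 1%R.
Proof. by rewrite /ballot bin0. Qed.

(** Symmetry of the binomial row of odd length. This zero is the boundary value at height -1 in the
    reflection principle, and it removes the missing up step when [m = 0]. *)
Lemma ballot_mid t : ballot (2 * t).+1 t.+1 = 0%R.
Proof.
rewrite /ballot -[X in (Posz X - _)%R]bin_sub; last by lia.
have -> : (2 * t).+1 - t.+1 = t by lia.
by rewrite subrr.
Qed.

Lemma path_count_PRook r m : path_count PRook r m = 'C(r, m).
Proof.
elim: r m => [|r IH] [|m] //=; rewrite !IH mul1n mul0n addn0 ?bin0 //.
by rewrite binS addnC.
Qed.

(** The two clauses are proved together: for [t = 0] the down step would come from a height larger
    than the number of steps, where only the vanishing clause applies. *)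
Lemma path_count_TL r m :
  (r < m -> path_count TL r m = 0) /\
  (forall t, r = m + 2 * t -> Posz (path_count TL r m) = ballot r t).
Proof.
elim: r m => [|r IH] m.
  split; first by case: m.
  by move=> t e; have [-> ->] : m = 0 /\ t = 0 by lia.
split.
  case: m => [|m] // lt_rm /=.
  by rewrite (IH m).1 ?(IH m.+2).1 //; lia.
case: m => [|m] t e.
  case: t e => [|t] e; first by lia.
  have er : r = 1 + 2 * t by lia.
  by rewrite ballotS /= !mul0n !add0n mul1n ((IH 1).2 t er) er ballot_mid add0r.
have er : r = m + 2 * t by lia.
rewrite /= mul0n addn0 mul1n PoszD ((IH m).2 t er).
case: t e er => [|t] e er; first by rewrite (IH m.+2).1 ?ballot0 //; lia.
have er' : r = m.+2 + 2 * t by lia.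
by rewrite ((IH m.+2).2 t er') ballotS.
Qed.

(** The binomial places the [m + 2 * t] non-level steps, of which [t] go down. The number [N] of
    summands is a free parameter because the recursion shortens the sum by one term in its down-step
    part. *)
Definition motzkin_sum (N r m : nat) : int :=
  (\sum_(t < N) Posz 'C(r, m + 2 * t) * ballot (m + 2 * t) t)%R.

Lemma motzkin_sum_recl N r m :
  motzkin_sum N.+1 r m = 
  (Posz 'C(r, m) + \sum_(t < N) Posz 'C(r, m.+2 + 2 * t) * ballot (m.+2 + 2 * t) t.+1)%R.
Proof.
rewrite /motzkin_sum big_ord_recl /= muln0 addn0 ballot0 mulr1; congr (_ + _)%R.
apply: eq_bigr => t _; rewrite /bump /= add1n.
by have -> : m + 2 * t.+1 = m.+2 + 2 * t by lia.
Qed.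

(** Pascal's rule for the positions separates a final level step; the ballot recursion then
    separates a final up step from a final down step. *)
Lemma motzkin_sumS N r m :
  motzkin_sum N.+1 r.+1 m =
  ((if m is m'.+1 then motzkin_sum N.+1 r m' else 0) + motzkin_sum N.+1 r m
   + motzkin_sum N r m.+1)%R.
Proof.
have split_tail : (\sum_(t < N) Posz 'C(r.+1, m.+2 + 2 * t) * ballot (m.+2 + 2 * t) t.+1 =
  \sum_(t < N) Posz 'C(r, m.+2 + 2 * t) * ballot (m.+2 + 2 * t) t.+1
  + \sum_(t < N) Posz 'C(r, m.+1 + 2 * t) * ballot (m.+1 + 2 * t) t.+1
  + motzkin_sum N r m.+1)%R.
  rewrite -!big_split; apply: eq_bigr => t _ /=.
  rewrite !addSn binS ballotS PoszD; ring.
case: m split_tail => [|m] split_tail.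
  rewrite !motzkin_sum_recl split_tail !bin0.
  (* For [m = 0] the middle sum is the contribution from height -1, and each of its terms is a
     ballot number at the wall. *)
  rewrite [X in (_ + X + _)%R]big1 ?addr0; first by ring.
  by move=> t _; rewrite add1n ballot_mid mulr0.
rewrite !motzkin_sum_recl split_tail binS PoszD; ring.
Qed.

Lemma path_count_Motz N r m : r < m + 2 * N -> Posz (path_count Motz r m) = motzkin_sum N r m.
Proof.
elim: r m N => [|r IH] m N lt_r.
  case: N lt_r => [|N] lt_r; first by rewrite /motzkin_sum big_ord0; case: m lt_r => //; lia.
  rewrite motzkin_sum_recl big1 ?addr0; first by case: m lt_r.
  by move=> t _; rewrite bin_small ?mul0r //; lia.
case: N lt_r => [|N] lt_r.
  rewrite /motzkin_sum big_ord0 /=; case: m lt_r => [|m] lt_r; first by lia.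
  have := IH m 0; have := IH m.+1 0; have := IH m.+2 0.
  by rewrite /motzkin_sum !big_ord0; lia.
rewrite motzkin_sumS /= !mul1n !PoszD -(IH m) -?(IH m.+1); try by lia.
by case: m lt_r => [|m] lt_r; rewrite -?(IH m) //; lia.
Qed.

Lemma binZ_nat r j : binZ r (Posz j) = Posz 'C(r, j).
Proof. by rewrite /binZ. Qed.

Lemma ballot_binZ M t : (binZ M (Posz t) - binZ M (Posz t - 1))%R = ballot M t.
Proof.
case: t => [|t]; first by rewrite /binZ /ballot.
have -> : (Posz t.+1 - 1)%R = Posz t by lia.
by rewrite !binZ_nat.
Qed.

Lemma path_count_Fval A r m : (A = TL -> odd m == odd r) ->
  Posz (path_count A r m) = Fval A m r.
Proof.
case: A => [/(_ erefl) /eqP par|_|_]; rewrite /Fval.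
- have [lt_rm|le_mr] := ltnP r m.
    rewrite (path_count_TL r m).1 // /binZ.
    (* Division rounds down, so even [r - m = -1] gives a negative lower index and both binomials
       vanish. *)
    have -> : (((Posz r - Posz m)%R %/ 2)%Z < 0)%R by lia.
    by have -> : (((Posz r - Posz m)%R %/ 2)%Z - 1 < 0)%R by lia.
  have [t e] : exists t, r = m + 2 * t by exists (r - m)./2; lia.
  rewrite ((path_count_TL r m).2 t) //.
  have -> : ((Posz r - Posz m)%R %/ 2)%Z = Posz t by lia.
  by rewrite ballot_binZ.
- rewrite (@path_count_Motz r.+1); last by lia.
  by apply: eq_bigr => t _; rewrite binZ_nat ballot_binZ.
- by rewrite path_count_PRook.
Qed.

(** * Half-diagrams and the recursion on the last active point *)

(** Defects and isolated points are both fixed by the involution; the second component tells them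
    apart. *)
Notation half_data k := ({ffun 'I_k -> 'I_k} * {set 'I_k})%type.

(* [p] exchanges the ends of each arc and [D] is the set of defects.  Only the
   points below [r] are active; beyond them [p] is the prescribed [sigma]. *)
Record half_diagram_spec (A : Alg) k (sigma : 'I_k -> 'I_k) (r m : nat)
    (p : 'I_k -> 'I_k) (D : {set 'I_k}) : Prop := HalfDiagramSpec {
  half_invol : forall i, p (p i) = i;
  half_defect : forall i, i \in D -> p i = i /\ i < r;
  half_tail : forall i : 'I_k, r <= i -> p i = sigma i;
  half_nocross : forall a b : 'I_k, a < b -> b < p a -> p a < p b -> False;
  half_nocover : forall a d : 'I_k, d \in D -> a < d -> d < p a -> False;
  half_card : #|D| = m;
  half_alg : match A with
    | TL => forall i : 'I_k, i < r -> p i = i -> i \in D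
    | Motz => True
    | PRook => forall i : 'I_k, i < r -> p i = i
    end }.

Definition half_diagramb (A : Alg) k (sigma : 'I_k -> 'I_k) (r m : nat)
    (p : 'I_k -> 'I_k) (D : {set 'I_k}) : bool :=
  [&& [forall i, p (p i) == i],
      [forall i in D, (p i == i) && (i < r)],
      [forall i : 'I_k, (r <= i) ==> (p i == sigma i)],
      [forall a : 'I_k, forall b : 'I_k, ~~ [&& a < b, b < p a & p a < p b]],
      [forall a : 'I_k, forall d in D, ~~ ((a < d) && (d < p a))],
      #|D| == m &
      match A with
      | TL => [forall i : 'I_k, (i < r) && (p i == i) ==> (i \in D)]
      | Motz => true
      | PRook => [forall i : 'I_k, (i < r) ==> (p i == i)]
      end].

Lemma half_diagramP A k (sigma : 'I_k -> 'I_k) r m p D :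
  reflect (half_diagram_spec A sigma r m p D) (half_diagramb A sigma r m p D).
Proof.
apply: (iffP idP) => [/and5P[/forallP h1 /forall_inP h2 /forallP h3 /forallP h4
                       /and3P[/forallP h5 /eqP h6 h7]]|[h1 h2 h3 h4 h5 h6 h7]].
split=> //.
- by move=> i; apply/eqP.
- by move=> i /h2 /andP[/eqP].
- by move=> i /(implyP (h3 i)) /eqP.
- by move=> a b ab ba c; move/forallP: (h4 a) => /(_ b); rewrite ab ba c.
- by move=> a d dD ad da; move/forall_inP: (h5 a) => /(_ d dD); rewrite ad da.
- case: A h7 => //.
    by move=> /forallP h i ir pi; move: (h i); rewrite ir pi eqxx.
  by move=> /forallP h i /(implyP (h i)) /eqP.
apply/and5P; split; last (apply/and3P; split).
- by apply/forallP => i; rewrite h1.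
- by apply/forall_inP => i /h2[-> ->]; rewrite eqxx.
- by apply/forallP => i; apply/implyP => /h3 ->.
- apply/forallP => a; apply/forallP => b; apply/negP => /and3P[x y z].
  exact: (h4 a b).
- apply/forallP => a; apply/forall_inP => b bD; apply/negP => /andP[x y].
  exact: (h5 a b).
- by rewrite h6.
- case: A h7 => // h.
    by apply/forallP => i; apply/implyP => /andP[ir /eqP pi]; apply: h.
  by apply/forallP => i; apply/implyP => /h ->.
Qed.

Definition half_diagrams (A : Alg) k (sigma : 'I_k -> 'I_k) (r m : nat) :
    {set half_data k} :=
  [set x : half_data k | half_diagramb A sigma r m x.1 x.2].

Lemma half_diagramsP A k (sigma : 'I_k -> 'I_k) r m (x : half_data k) :
  reflect (half_diagram_spec A sigma r m x.1 x.2) (x \in half_diagrams A sigma r m).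
Proof. by rewrite inE; apply: half_diagramP. Qed.

Lemma card_half_diagrams0 A k (sigma : 'I_k -> 'I_k) m :
  involutive sigma ->
  (forall a b : 'I_k, a < b -> b < sigma a -> sigma a < sigma b -> False) ->
  #|half_diagrams A sigma 0 m| = (m == 0).
Proof.
move=> sigmaK sigma_nc; case: m => [|m]; last first.
  apply/eqP; rewrite cards_eq0; apply/eqP/setP => -[p D]; rewrite [in RHS]inE.
  apply/negP => /half_diagramsP[_ hD _ _ _ /= cD _].
  have /set0Pn[i /hD[]] // : D != set0 by rewrite -card_gt0 cD.
apply: (@eq_card1 _ ([ffun i => sigma i], set0)) => -[p D]; rewrite [in RHS]inE.
apply/half_diagramsP/eqP => [[_ hD ht _ _ /= cD _]|[-> ->]].
  congr pair; first by apply/ffunP => i; rewrite ffunE ht.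
  by apply/eqP; rewrite -cards_eq0 cD.
split=> //=.
- by move=> i; rewrite !ffunE.
- by move=> i; rewrite inE.
- by move=> i _; rewrite ffunE.
- by move=> a b; rewrite !ffunE; apply: sigma_nc.
- by move=> a d; rewrite inE.
- exact: cards0.
- by case: A.
Qed.

(** No arc joins the tail to an active point: such an arc would be prescribed by [sigma], which
    fixes its active end. The threshold [r0] stays put while [r] descends, so the points between
    them are idle fixed points. *)
Lemma tail_fix_stable A k (sigma : 'I_k -> 'I_k) r0 r m p D :
  r <= r0 -> involutive sigma -> (forall i : 'I_k, i < r0 -> sigma i = i) ->
  half_diagram_spec A sigma r m p D ->
  forall i : 'I_k, r <= i -> r <= p i.
Proof.
move=> le_r sigmaK sigma_fix [pK _ pt _ _ _ _] i le_i.
rewrite leqNgt; apply/negP => lt_pi.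
have e := pt _ le_i; have := sigma_fix (p i) (leq_trans lt_pi le_r).
by rewrite e sigmaK => e'; move: lt_pi; rewrite e -e' ltnNge le_i.
Qed.

(** Removing [rho] from the defects, with the involution unchanged, is a bijection onto the
    half-diagrams with one active point and one defect less. *)
Lemma card_defect_last A k (sigma : 'I_k -> 'I_k) r0 (rho : 'I_k) m :
  rho < r0 -> involutive sigma -> (forall i : 'I_k, i < r0 -> sigma i = i) ->
  #|half_diagrams A sigma rho.+1 m :&: [set x : half_data k | rho \in x.2]| =
  if m is m'.+1 then #|half_diagrams A sigma rho m'| else 0.
Proof.
move=> lt_r sigmaK sigma_fix; case: m => [|m].
  apply/eqP; rewrite cards_eq0; apply/eqP/setP => -[p D]; rewrite [in RHS]inE.
  apply/negP => /setIP[/half_diagramsP[_ _ _ _ _ /= /eqP]].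
  by rewrite cards_eq0 => /eqP -> _; rewrite !inE.
pose f (x : half_data k) := (x.1, rho |: x.2).
have notin p D : half_diagram_spec A sigma rho m p D -> rho \notin D.
  by case=> _ hD _ _ _ _ _; apply/negP => /hD[_]; rewrite ltnn.
have f_inj : {in half_diagrams A sigma rho m &, injective f}.
  move=> [p D] [p' D'] /half_diagramsP/notin/= nD /half_diagramsP/notin/= nD' [-> eD].
  by rewrite -(setU1K nD) eD setU1K.
rewrite -(card_in_imset f_inj); apply: eq_card => -[p D].
apply/setIP/imsetP => [[/half_diagramsP[/= pK hD pt nc nest cD hA]]|[[p' D'] hx [-> ->]]].
  rewrite inE /= => rD; exists (p, D :\ rho); last by rewrite /f /= setD1K.
  have [p_rho _] := hD _ rD.
  apply/half_diagramsP; split=> //=.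
  - move=> i; rewrite !inE => /andP[ne /hD[-> lt]]; split=> //.
    by rewrite ltn_neqAle ne -ltnS.
  - move=> i le_i; have [->|ne] := eqVneq i rho; first by rewrite p_rho sigma_fix.
    by apply: pt; rewrite ltn_neqAle eq_sym ne.
  - by move=> a d; rewrite !inE => /andP[_ dD]; apply: nest.
  - by have := cardsD1 rho D; rewrite rD cD => -[].
  - case: A hA {notin f_inj} => // h i lt.
      move=> e; rewrite !inE h ?(leqW lt) // andbT.
      by apply: contraTneq lt => ->; rewrite ltnn.
    by apply: h; apply: leqW.
move: (hx) => /half_diagramsP /= hx'.
have nD := notin _ _ hx'; have st := tail_fix_stable (ltnW lt_r) sigmaK sigma_fix hx'.
case: hx' => pK hD pt nc nest cD hA.
have p_rho : p' rho = rho by rewrite pt // sigma_fix.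
split; last by rewrite !inE eqxx.
apply/half_diagramsP; split=> //=.
- by move=> i; rewrite !inE => /orP[/eqP->|/hD[-> lt]]; split=> //; rewrite ltnW.
- by move=> i le_i; apply: pt; rewrite ltnW.
(* An arc over the new defect [rho] would end in the tail, hence also begin there. *)
- move=> a d; rewrite !inE => /orP[/eqP->|]; last exact: nest.
  by move=> lt_a lt_p; have := st (p' a) (ltnW lt_p); rewrite pK leqNgt lt_a.
- by rewrite cardsU1 nD cD.
- case: A hA {hx notin f_inj st} => // h i; rewrite ltnS leq_eqVlt => /orP[/eqP/val_inj->|lt] //.
  + by rewrite !inE eqxx.
  + by move=> e; rewrite !inE h ?orbT.
  + exact: h.
Qed.

(** No bijection is required: an isolated [rho] is exactly what the tail condition at [rho] demands,
    since [sigma] fixes it, so the two sets coincide. For [TL] a fixed active point must be a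
    defect. *)
Lemma card_isolated_last A k (sigma : 'I_k -> 'I_k) r0 (rho : 'I_k) m :
  rho < r0 -> (forall i : 'I_k, i < r0 -> sigma i = i) ->
  #|half_diagrams A sigma rho.+1 m :&: [set x : half_data k | (rho \notin x.2) && (x.1 rho == rho)]| =
  not_TL A * #|half_diagrams A sigma rho m|.
Proof.
move=> lt_r sigma_fix; have [A_TL|nA] := boolP (not_TL A); last first.
  apply/eqP; rewrite mul0n cards_eq0; apply/eqP/setP => -[p D]; rewrite [in RHS]inE.
  case: A nA => // _; apply/negP => /setIP[/half_diagramsP[_ _ _ _ _ _ /= h]].
  by rewrite !inE => /andP[/negP nD /eqP e]; apply: nD; apply: h.
rewrite mul1n; apply: eq_card => -[p D]; apply/setIP/half_diagramsP => /=.
  case=> /half_diagramsP[/= pK hD pt nc nest cD hA]; rewrite inE /= => /andP[rD /eqP p_rho].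
  split=> //.
  - move=> i iD; have [-> lt] := hD i iD; split=> //.
    by rewrite ltn_neqAle -ltnS lt andbT; apply: contraNneq rD => /val_inj <-.
  - move=> i le_i; have [->|ne] := eqVneq i rho; first by rewrite p_rho sigma_fix.
    by apply: pt; rewrite ltn_neqAle eq_sym ne.
  - by case: A hA A_TL => // h _ i lt; apply: h; rewrite ltnW.
move=> [pK hD pt nc nest cD hA].
have p_rho : p rho = rho by rewrite pt // sigma_fix.
split; last first.
  by rewrite inE /= p_rho eqxx andbT; apply/negP => /hD[_]; rewrite ltnn.
apply/half_diagramsP; split=> //=.
- by move=> i /hD[-> lt]; split=> //; rewrite ltnW.
- by move=> i le_i; apply: pt; rewrite ltnW.
- case: A hA A_TL => // h _ i; rewrite ltnS leq_eqVlt => /orP[/eqP/val_inj->|lt] //.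
  exact: h.
Qed.

(** One formula both for cutting the arc between [i] and [j] (new values [i], [j]) and for drawing
    it (new values [j], [i]). *)
Definition relink k (p : {ffun 'I_k -> 'I_k}) (i j i' j' : 'I_k) : {ffun 'I_k -> 'I_k} :=
  [ffun x => if x == i then i' else if x == j then j' else p x].

(** Cutting the arc at [rho] is reversible: a defect to the right of its left end would lie under
    the arc, so the left end can be recognised afterwards. The inverse joins [rho] to the last of
    the [m.+1] defects. *)
Lemma card_arc_last A k (sigma : 'I_k -> 'I_k) r0 (rho : 'I_k) m :
  rho < r0 -> involutive sigma -> (forall i : 'I_k, i < r0 -> sigma i = i) ->
  #|half_diagrams A sigma rho.+1 m :&: [set x : half_data k | x.1 rho != rho]| =
  not_PRook A * #|half_diagrams A sigma rho m.+1|.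
Proof.
move=> lt_r sigmaK sigma_fix; have [A_PR|nA] := boolP (not_PRook A); last first.
  apply/eqP; rewrite mul0n cards_eq0; apply/eqP/setP => -[p D]; rewrite [in RHS]inE.
  case: A nA => // _; apply/negP => /setIP[/half_diagramsP[_ _ _ _ _ _ /= h]].
  by rewrite inE /= h ?eqxx.
rewrite mul1n.
pose g (x : half_data k) :=
  (relink x.1 (x.1 rho) rho (x.1 rho) rho, x.1 rho |: x.2).
set P := _ :&: _.
(* The left end of the last arc becomes the rightmost defect. *)
have facts p D : (p, D) \in P -> [/\ half_diagram_spec A sigma rho.+1 m p D,
    p rho < rho, p rho \notin D & forall d, d \in D -> d < p rho].
  case/setIP=> /half_diagramsP /= hx; rewrite inE /= => ne.
  have lt_p : p rho < rho.
    have st := tail_fix_stable lt_r sigmaK sigma_fix hx.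
    have [lt|gt|e] := ltngtP (p rho) rho => //; last by rewrite (val_inj e) eqxx in ne.
    by case: hx => pK *; have := st _ gt; rewrite pK ltnn.
  case: (hx) => pK hD pt nc nest cD hA.
  have nD : p rho \notin D.
    by apply/negP => /hD[]; rewrite pK => e _; rewrite -e eqxx in ne.
  split=> // d dD; have [//|gt|e] := ltngtP d (p rho); last first.
    by rewrite -(val_inj e) dD in nD.
  have [e lt] := hD d dD; exfalso; apply: (nest (p rho) d) => //; rewrite pK ltn_neqAle -ltnS lt.
  rewrite andbT; apply: contraNneq ne => /val_inj <-; exact/eqP.
have g_inj : {in P &, injective g}.
  move=> [p D] [p' D'] /facts[hx lt nD mx] /facts[hx' lt' nD' mx'] [/= ep eD].
  (* Each left end is the maximum of its enlarged defect set, and the two enlarged sets agree. *)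
  have ej : p rho = p' rho.
    apply/val_inj/eqP; rewrite /= eqn_leq; apply/andP; split.
      have : p rho \in p' rho |: D' by rewrite -eD !inE eqxx.
      by rewrite !inE => /orP[/eqP->|/mx'/ltnW].
    have : p' rho \in p rho |: D by rewrite eD !inE eqxx.
    by rewrite !inE => /orP[/eqP->|/mx/ltnW].
  congr pair; last by rewrite -(setU1K nD) eD ej setU1K.
  apply/ffunP => i; have := congr1 (fun f : {ffun 'I_k -> 'I_k} => f i) ep.
  rewrite /relink !ffunE -ej; case: eqP => [->|_]; last by case: eqP => [->|].
  by case: hx hx' => pK _ _ _ _ _ _ [p'K _ _ _ _ _ _]; rewrite pK ej p'K.
rewrite -(card_in_imset g_inj); apply: eq_card => -[q E].
apply/imsetP/half_diagramsP => [[[p D] /facts[hx lt nD mx] [-> ->]]|hx] /=.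
  have st := tail_fix_stable lt_r sigmaK sigma_fix hx.
  case: hx => pK hD pt nc nest cD hA; set j := p rho in lt nD mx *.
  have pj : p j = rho by rewrite pK.
  have qE (i : 'I_k) : relink p j rho j rho i = if (i == j) || (i == rho) then i else p i.
    by rewrite /relink ffunE; do 2!case: eqP => //.
  have q_arc (i : 'I_k) : i < relink p j rho j rho i -> relink p j rho j rho i = p i.
    by rewrite qE; case: ifP => //; rewrite ltnn.
  split.
  - move=> i; rewrite !qE; case h : ((i == j) || (i == rho)); first by rewrite h.
    rewrite (_ : (p i == j) || (p i == rho) = false) ?pK //.
    by apply: contraFF h => /orP[]/eqP e; rewrite -(pK i) e ?pj eqxx ?orbT.
  - move=> i; rewrite !inE qE => /orP[/eqP->|iD]; first by rewrite eqxx.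
    have [-> _] := hD i iD; rewrite if_same; split=> //.
    exact: ltn_trans (mx _ iD) lt.
  - move=> i le_i; rewrite qE; have [->|ne] := eqVneq i rho.
      by rewrite orbT sigma_fix.
    rewrite orbF; case: eqP => [e|_]; first by rewrite e leqNgt lt in le_i.
    by apply: pt; rewrite ltn_neqAle eq_sym ne.
  - move=> a b ab; move=> h1 h2.
    have e1 := q_arc a (ltn_trans ab h1).
    have e2 := q_arc b (ltn_trans h1 h2).
    by apply: (nc a b) => //; rewrite -?e1 -?e2.
  - move=> a d; rewrite !inE => /orP[/eqP->|dD] h1 h2.
      have e1 := q_arc a (ltn_trans h1 h2).
      move: h2; rewrite e1 => h2.
      (* Suppose an arc from [a] covers the new defect [j]. Ending before [rho] it crosses the old
         arc from [j] to [rho]; ending beyond [rho] it would start in the tail; ending at [rho] it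
         is the old arc, so [a = j]. *)
      have [lt2|gt2|e2] := ltngtP (p a) rho.
      + by apply: (nc a j) => //; rewrite pj.
      + have := st _ gt2; rewrite pK ltnNge => /negP; apply; apply: ltnW; exact: ltn_trans h1 lt.
      + move: h1; rewrite -(pK a) (val_inj e2); by rewrite ltnn.
    have e1 := q_arc a (ltn_trans h1 h2).
    by apply: (nest a d) => //; rewrite -e1.
  - by rewrite cardsU1 nD cD.
  - case: A hA A_PR {facts g_inj P} => // h _ i lt_i.
    rewrite qE !inE; have [->//|_] := eqVneq i j.
    by case: eqP => [e|_ e]; [rewrite e ltnn in lt_i | apply: h; rewrite // ltnW].
have st := tail_fix_stable (ltnW lt_r) sigmaK sigma_fix hx.
case: (hx) => qK hE qt nc nest cE hA.
have /card_gt0P[d0 d0E] : 0 < #|E| by rewrite cE.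
(* The rightmost defect is the only admissible left end, since any other choice would leave a defect
   under the new arc. *)
have [j jE jmax] := arg_maxnP (fun i : 'I_k => i : nat) d0E.
have {}jE : j \in E := jE.
have [qj lt_j] := hE j jE.
have q_rho : q rho = rho by rewrite qt // sigma_fix.
have ne_j : (rho == j) = false by apply/negbTE; rewrite eq_sym; apply: contraTneq lt_j => ->; rewrite ltnn.
pose p := relink q j rho rho j.
have p_j : p j = rho by rewrite /p /relink ffunE eqxx.
have p_rho : p rho = j by rewrite /p /relink ffunE ne_j eqxx.
have pE i : i != j -> i != rho -> p i = q i.
  by rewrite /p /relink ffunE => /negbTE-> /negbTE->.
exists (p, E :\ j); last first.
  rewrite /g /= p_rho setD1K //; congr pair; apply/ffunP => i.
  rewrite ffunE; have [->//|n1] := eqVneq i j; have [->//|n2] := eqVneq i rho.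
  by rewrite pE.
apply/setIP; split; last by rewrite inE /= p_rho eq_sym ne_j.
have q_ne i : i != j -> i != rho -> (q i != j) && (q i != rho).
  move=> n1 n2; apply/andP; split; apply: contra_neq n1 => e; first by rewrite -(qK i) e.
  by move: n2; rewrite -(qK i) e q_rho eqxx.
apply/half_diagramsP; split=> /=.
- move=> i; have [->|n1] := eqVneq i j; first by rewrite p_j.
  have [->|n2] := eqVneq i rho; first by rewrite p_rho.
  by have /andP[n3 n4] := q_ne i n1 n2; rewrite pE // pE // qK.
- move=> i; rewrite !inE => /andP[n1 iE]; have [qi lt_i] := hE i iE.
  have n2 : i != rho by apply: contraTneq lt_i => ->; rewrite ltnn.
  by rewrite pE // ltnS ltnW.
- move=> i lt_i; rewrite pE; first by rewrite qt // ltnW.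
    by apply: contraTneq lt_i => ->; rewrite ltnNge ltnW.
  by apply: contraTneq lt_i => ->; rewrite ltnn.
- move=> a b ab.
  have [ea|n1] := eqVneq a j.
    rewrite ea p_j => b_rho; rewrite pE; last 2 first.
    + by apply: contraTneq ab => ->; rewrite ea ltnn.
    + by apply: contraTneq b_rho => ->; rewrite ltnn.
    by move=> h; have := st _ (ltnW h); rewrite qK leqNgt b_rho.
  have [ea|n2] := eqVneq a rho.
    by rewrite ea p_rho => b_j; have := ltn_trans ab b_j; rewrite ea ltnNge (ltnW lt_j).
  rewrite (pE a) //.
  (* An old arc crossing the new one at its left end would have covered the defect [j]. *)
  have [eb|n3] := eqVneq b j.
    by rewrite eb p_j => h1 h2; apply: (nest a j) => //; rewrite -eb.
  have [eb|n4] := eqVneq b rho.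
    by rewrite eb p_rho => h1 h2; have := ltn_trans h1 h2; rewrite ltnNge ltnW.
  by rewrite pE //; apply: nc.
- move=> a d; rewrite !inE => /andP[nd dE] ad.
  have [ea|n1] := eqVneq a j; first by have := jmax d dE; rewrite /= leqNgt -ea ad.
  have [ea|n2] := eqVneq a rho.
    by have [_] := hE d dE; rewrite ltnNge -ea (ltnW ad).
  by rewrite pE //; apply: nest.
- by have := cardsD1 j E; rewrite jE cE => -[].
- case: A hA A_PR {facts g_inj hx P} => // h _ i; rewrite ltnS leq_eqVlt => /orP[/eqP/val_inj->|lt_i].
    by rewrite p_rho => e; rewrite e eqxx in ne_j.
  rewrite !inE; have [->|n1] := eqVneq i j.
    by rewrite p_j => e; rewrite e eqxx in ne_j.
  by rewrite pE // => [/(h _ lt_i)|] //; apply: contraTneq lt_i => ->; rewrite ltnn.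
Qed.

Lemma card_half_diagrams A k (sigma : 'I_k -> 'I_k) r0 r m :
  r <= r0 -> r0 <= k -> involutive sigma -> (forall i : 'I_k, i < r0 -> sigma i = i) ->
  (forall a b : 'I_k, a < b -> b < sigma a -> sigma a < sigma b -> False) ->
  #|half_diagrams A sigma r m| = path_count A r m.
Proof.
move=> le_r le_k sigmaK sigma_fix sigma_nc; elim: r m le_r => [|r IH] m le_r.
  exact: card_half_diagrams0.
have lt_k := leq_trans le_r le_k; pose rho := Ordinal lt_k.
rewrite -(cardsID [set x : half_data k | x.1 rho != rho]) (card_arc_last A (rho := rho) m le_r) //.
rewrite -(cardsID [set x : half_data k | rho \in x.2]).
have -> : (half_diagrams A sigma r.+1 m :\: [set x : half_data k | x.1 rho != rho]) :&: [set x : half_data k | rho \in x.2]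
   = half_diagrams A sigma rho.+1 m :&: [set x : half_data k | rho \in x.2].
  apply/setP => -[p D]; apply/setIP/setIP => [[/setDP[]//]|[h1 h2]]; split=> //.
  apply/setDP; split=> //; rewrite inE negbK; move: h2; rewrite inE.
  by case/half_diagramsP: h1 => _ h _ _ _ _ _ /h[->].
have -> : (half_diagrams A sigma r.+1 m :\: [set x : half_data k | x.1 rho != rho]) :\: [set x : half_data k | rho \in x.2]
   = half_diagrams A sigma rho.+1 m :&: [set x : half_data k | (rho \notin x.2) && (x.1 rho == rho)].
  by apply/setP => -[p D]; rewrite !inE /= negbK andbA andbC andbA.
rewrite (card_defect_last A (rho := rho) m le_r) //.
rewrite (card_isolated_last A (rho := rho) m le_r) //= !IH ?(ltnW le_r) //.
by case: m => [|m]; rewrite ?IH ?(ltnW le_r) // addnC.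
Qed.

(** * Symmetric diagrams as set partitions *)

Lemma partition_blockP (X : finType) (P : {set {set X}}) (E : {set X}) :
  reflect [/\ set0 \notin P,
              forall x, x \in E <-> exists2 B, B \in P & x \in B &
              forall B C x, B \in P -> C \in P -> x \in B -> x \in C -> B = C]
          (partition P E).
Proof.
apply: (iffP and3P) => [[/eqP covP /trivIsetP triv P0]|[P0 cov triv]]; split=> //.
- move=> x; rewrite -covP; split=> [/bigcupP[B]|[B BP xB]]; first by exists B.
  by apply/bigcupP; exists B.
- move=> B C x BP CP xB xC; apply/eqP; apply: contraT => /(triv _ _ BP CP).
  by move/disjointFr => /(_ x xB); rewrite xC.
- apply/eqP/setP => x; apply/bigcupP/idP => [[B BP xB]|/cov[B]]; last by exists B.
  by apply/cov; exists B.
- apply/trivIsetP => B C BP CP; apply: contra_neqT => /pred0Pn[x /andP[xB xC]].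
  exact: triv xB xC.
Qed.

(* The symmetric diagram with vertical strands at [D] and, in both rows, the
   blocks in [T]; it is a set partition when [partition T (~: D)] holds. *)
Definition dgm k (D : {set 'I_k}) (T : {set {set 'I_k}}) : diagram k :=
  [set [set (inl i : V k); inr i] | i in D] :|: (@topB k) @: T :|: (@botB k) @: T.

Lemma in_topB k (B : {set 'I_k}) v : (v \in topB B) = if v is inl i then i \in B else false.
Proof.
case: v => i /=; first by apply/imsetP/idP => [[j jB [->]]|iB] //; exists i.
by apply/imsetP => -[].
Qed.

Lemma in_botB k (B : {set 'I_k}) v : (v \in botB B) = if v is inr i then i \in B else false.
Proof.
case: v => i /=; last by apply/imsetP/idP => [[j jB [->]]|iB] //; exists i.
by apply/imsetP => -[].
Qed.

Lemma topB_inj k : injective (@topB k).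
Proof. by move=> B C e; apply/setP => i; have /setP/(_ (inl i)) := e; rewrite !in_topB. Qed.

Lemma botB_inj k : injective (@botB k).
Proof. by move=> B C e; apply/setP => i; have /setP/(_ (inr i)) := e; rewrite !in_botB. Qed.

Lemma in_through k (i : 'I_k) v :
  (v \in [set (inl i : V k); inr i]) = match v with inl j => j == i | inr j => j == i end.
Proof. by rewrite !inE; case: v => j; rewrite /eq_op /= ?orbF. Qed.

Lemma dgmP k (D : {set 'I_k}) (T : {set {set 'I_k}}) B :
  reflect [\/ exists2 i, i \in D & B = [set (inl i : V k); inr i],
              exists2 C, C \in T & B = topB C | exists2 C, C \in T & B = botB C]
          (B \in dgm D T).
Proof.
apply: (iffP idP) => [/setUP[/setUP[]|]/imsetP h|[] h].
- exact: Or31.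
- exact: Or32.
- exact: Or33.
- by apply/setUP; left; apply/setUP; left; apply/imsetP.
- by apply/setUP; left; apply/setUP; right; apply/imsetP.
- by apply/setUP; right; apply/imsetP.
Qed.

Lemma through_dgm k (D : {set 'I_k}) (T : {set {set 'I_k}}) i : i \in D -> [set (inl i : V k); inr i] \in dgm D T.
Proof. by move=> iD; apply/dgmP; apply: Or31; exists i. Qed.

Lemma top_dgm k (D : {set 'I_k}) (T : {set {set 'I_k}}) C : C \in T -> topB C \in dgm D T.
Proof. by move=> CT; apply/dgmP; apply: Or32; exists C. Qed.

Lemma bot_dgm k (D : {set 'I_k}) (T : {set {set 'I_k}}) C : C \in T -> botB C \in dgm D T.
Proof. by move=> CT; apply/dgmP; apply: Or33; exists C. Qed.

Lemma dgm_partition k (D : {set 'I_k}) (T : {set {set 'I_k}}) : partition T (~: D) -> partition (dgm D T) [set: V k].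
Proof.
move=> /partition_blockP[T0 cov triv].
have notD C i : C \in T -> i \in C -> i \in D = false.
  by move=> CT iC; apply/negbTE; rewrite -in_setC; apply/cov; exists C.
apply/partition_blockP; split.
- apply/negP => /dgmP[[i _ /setP/(_ (inl i))]|[C CT e]|[C CT e]].
  + by rewrite in_through eqxx inE.
  + have C0 : C = set0 by apply: topB_inj; rewrite -e /topB imset0.
    by rewrite -C0 CT in T0.
  + have C0 : C = set0 by apply: botB_inj; rewrite -e /botB imset0.
    by rewrite -C0 CT in T0.
- move=> x; split=> // _; case: x => i; have [iD|] := boolP (i \in D).
  + by exists [set inl i; inr i]; rewrite ?through_dgm // in_through.
  + by rewrite -in_setC => /cov[C CT iC]; exists (topB C); rewrite ?top_dgm ?in_topB.
  + by exists [set inl i; inr i]; rewrite ?through_dgm // in_through.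
  + by rewrite -in_setC => /cov[C CT iC]; exists (botB C); rewrite ?bot_dgm ?in_botB.
- move=> B C x /dgmP[][b bT ->] /dgmP[][c cT ->];
    case: x => i; rewrite ?in_through ?in_topB ?in_botB //.
  + by move=> /eqP <- /eqP <-.
  + by move=> /eqP <- /eqP <-.
  + by move=> /eqP eb; rewrite -eb in bT => /(notD _ _ cT); rewrite bT.
  + by move=> /eqP eb; rewrite -eb in bT => /(notD _ _ cT); rewrite bT.
  + by move=> /(notD _ _ bT) h /eqP e; rewrite -e h in cT.
  + by move=> ib ic; rewrite (triv b c i).
  + by move=> /(notD _ _ bT) h /eqP e; rewrite -e h in cT.
  + by move=> ib ic; rewrite (triv b c i).
Qed.

(** * Components of two stacked diagrams *)

(** The tool for bounding components from above: a function that is constant along edges separates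
    vertices with different values. *)
Lemma connect_invariant (X : finType) (Y : Type) (e : rel X) (f : X -> Y) x y :
  (forall u v, e u v -> f u = f v) -> connect e x y -> f x = f y.
Proof.
move=> inv /connectP[s es ->]; elim: s x es => //= z s IH x /andP[/inv-> /IH].
by [].
Qed.

Lemma stackrelP k (d1 d2 : diagram k) x y :
  reflect ((exists B u v, [/\ B \in d1, u \in B, v \in B, x = emb1 u & y = emb1 v]) \/
           (exists B u v, [/\ B \in d2, u \in B, v \in B, x = emb2 u & y = emb2 v]))
          (stackrel d1 d2 x y).
Proof.
apply: (iffP orP) => [[]/exists_inP[B Bd /andP[/imsetP[u uB ->] /imsetP[v vB ->]]]|[]].
- by left; exists B, u, v.
- by right; exists B, u, v.
- move=> [B [u [v [Bd uB vB -> ->]]]]; left; apply/exists_inP; exists B => //.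
  by rewrite !imset_f.
- move=> [B [u [v [Bd uB vB -> ->]]]]; right; apply/exists_inP; exists B => //.
  by rewrite !imset_f.
Qed.

Lemma stack1 k (d1 d2 : diagram k) B u v :
  B \in d1 -> u \in B -> v \in B -> connect (stackrel d1 d2) (emb1 u) (emb1 v).
Proof. by move=> Bd uB vB; apply/connect1/stackrelP; left; exists B, u, v. Qed.

Lemma stack2 k (d1 d2 : diagram k) B u v :
  B \in d2 -> u \in B -> v \in B -> connect (stackrel d1 d2) (emb2 u) (emb2 v).
Proof. by move=> Bd uB vB; apply/connect1/stackrelP; right; exists B, u, v. Qed.

Lemma compose_eq k (d1 d2 w : diagram k) : partition w [set: V k] ->
  (forall u v, connect (stackrel d1 d2) (embO u) (embO v) -> pblock w u = pblock w v) ->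
  (forall B u v, B \in w -> u \in B -> v \in B ->
     connect (stackrel d1 d2) (embO u) (embO v)) ->
  compose d1 d2 = w.
Proof.
move=> pw h1 h2; have /and3P[/eqP cw tw w0] := pw.
have mem u : u \in pblock w u by rewrite mem_pblock cw inE.
have class u : [set v | connect (stackrel d1 d2) (embO u) (embO v)] = pblock w u.
  apply/setP => v; rewrite inE; apply/idP/idP => [/h1->|vu]; first exact: mem.
  by apply: (h2 (pblock w u)) => //; rewrite pblock_mem // cw inE.
apply/setP => B; apply/imsetP/idP => [[u _ ->]|Bw].
  by rewrite class pblock_mem // cw inE.
have /set0Pn[u uB] : B != set0 by apply: contraNneq w0 => <-.
by exists u; rewrite // class (def_pblock tw Bw uB).
Qed.

(** Collapsing the two upper levels to one row sends every edge of the stack into a block of [w], so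
    blocks of [w] do not merge. Conversely the strands at [D] and the shared blocks in [T] keep each
    block of [w] connected. *)
Lemma compose_dgml k (D : {set 'I_k}) (T : {set {set 'I_k}}) (w : diagram k) :
  partition T (~: D) -> partition w [set: V k] -> (forall C, C \in T -> topB C \in w) ->
  compose (dgm D T) w = w.
Proof.
move=> pT pw Tw; have /partition_blockP[T0 cov triv] := pT.
have /and3P[/eqP cw tw w0] := pw.
have /partition_blockP[_ _ uniqw] := pw.
apply: compose_eq => // [u v|B u v Bw uB vB].
- pose f (x : W k) := pblock w (if x.1 == lev2 then inr x.2 else inl x.2).
  have fO z : f (embO z) = pblock w z by case: z.
  rewrite -!fO; apply: connect_invariant => x y /stackrelP[].
  + move=> [B [a [b [/dgmP[[i _ ->]|[C CT ->]|[C CT ->]] aB bB -> ->]]]].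
    * by move: aB bB; rewrite !in_through /f; case: a b => a [] b /= /eqP-> /eqP->.
    * move: aB bB; rewrite !in_topB /f; case: a b => a [] b //= aC bC.
      by rewrite !(def_pblock tw (Tw _ CT)) ?in_topB.
    * move: aB bB; rewrite !in_botB /f; case: a b => a [] b //= aC bC.
      by rewrite !(def_pblock tw (Tw _ CT)) ?in_topB.
  + move=> [B [a [b [Bw aB bB -> ->]]]].
    have f2 z : f (emb2 z) = pblock w z by case: z.
    by rewrite !f2 !(def_pblock tw Bw).
- have step i : i \in D -> connect (stackrel (dgm D T) w) (lev0, i) (lev1, i)
              /\ connect (stackrel (dgm D T) w) (lev1, i) (lev0, i).
    move=> iD; split.
      by apply: (stack1 (u := inl i) (v := inr i) _ (through_dgm T iD)); rewrite in_through.
    by apply: (stack1 (u := inr i) (v := inl i) _ (through_dgm T iD)); rewrite in_through.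
  have tail i : inl i \in B -> i \notin D -> exists2 C, C \in T & B = topB C.
    rewrite -in_setC => iB /cov[C CT iC]; exists C => //.
    by apply: (uniqw _ _ (inl i)) => //; rewrite ?Tw // in_topB.
  (* A block of [w] with a top vertex outside [D] is itself one of the blocks in [T], present in the
     top row of the left factor. Otherwise each of its top vertices sits under a strand leading to
     the middle row. *)
  have [[C CT eB]|notail] : (exists2 C, C \in T & B = topB C)
      \/ forall i, inl i \in B -> i \in D.
    have [/forallP h|/forallPn[i]] := boolP [forall i, (inl i \in B) ==> (i \in D)].
      by right=> i; move/implyP: (h i).
    by rewrite negb_imply => /andP[iB /(tail _ iB)]; left.
    move: uB vB; rewrite eB !in_topB; case: u v => u [] v //= uC vC.
    apply: (stack1 (u := inl u) (v := inl v) _ (top_dgm D CT)); by rewrite in_topB.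
  case: u v uB vB => u [] v uB vB.
  + apply: connect_trans (step _ (notail _ uB)).1 _.
    apply: connect_trans (step _ (notail _ vB)).2.
    exact: (stack2 _ Bw uB vB).
  + apply: connect_trans (step _ (notail _ uB)).1 _.
    exact: (stack2 _ Bw uB vB).
  + apply: connect_trans (step _ (notail _ vB)).2.
    exact: (stack2 _ Bw uB vB).
  + exact: (stack2 _ Bw uB vB).
Qed.

(** Mirror image of the left-hand case: the two lower levels are collapsed. *)
Lemma compose_dgmr k (D : {set 'I_k}) (T : {set {set 'I_k}}) (w : diagram k) :
  partition T (~: D) -> partition w [set: V k] -> (forall C, C \in T -> botB C \in w) ->
  compose w (dgm D T) = w.
Proof.
move=> pT pw Tw; have /partition_blockP[T0 cov triv] := pT.
have /and3P[/eqP cw tw w0] := pw.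
have /partition_blockP[_ _ uniqw] := pw.
apply: compose_eq => // [u v|B u v Bw uB vB].
- pose f (x : W k) := pblock w (if x.1 == lev0 then inl x.2 else inr x.2).
  have fO z : f (embO z) = pblock w z by case: z.
  rewrite -!fO; apply: connect_invariant => x y /stackrelP[].
  + move=> [B [a [b [Bw aB bB -> ->]]]].
    have f1 z : f (emb1 z) = pblock w z by case: z.
    by rewrite !f1 !(def_pblock tw Bw).
  + move=> [B [a [b [/dgmP[[i _ ->]|[C CT ->]|[C CT ->]] aB bB -> ->]]]].
    * by move: aB bB; rewrite !in_through /f; case: a b => a [] b /= /eqP-> /eqP->.
    * move: aB bB; rewrite !in_topB /f; case: a b => a [] b //= aC bC.
      by rewrite !(def_pblock tw (Tw _ CT)) ?in_botB.
    * move: aB bB; rewrite !in_botB /f; case: a b => a [] b //= aC bC.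
      by rewrite !(def_pblock tw (Tw _ CT)) ?in_botB.
- have step i : i \in D -> connect (stackrel w (dgm D T)) (lev2, i) (lev1, i)
              /\ connect (stackrel w (dgm D T)) (lev1, i) (lev2, i).
    move=> iD; split.
      by apply: (stack2 (u := inr i) (v := inl i) _ (through_dgm T iD)); rewrite in_through.
    by apply: (stack2 (u := inl i) (v := inr i) _ (through_dgm T iD)); rewrite in_through.
  have tail i : inr i \in B -> i \notin D -> exists2 C, C \in T & B = botB C.
    rewrite -in_setC => iB /cov[C CT iC]; exists C => //.
    by apply: (uniqw _ _ (inr i)) => //; rewrite ?Tw // in_botB.
  have [[C CT eB]|notail] : (exists2 C, C \in T & B = botB C)
      \/ forall i, inr i \in B -> i \in D.
    have [/forallP h|/forallPn[i]] := boolP [forall i, (inr i \in B) ==> (i \in D)].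
      by right=> i; move/implyP: (h i).
    by rewrite negb_imply => /andP[iB /(tail _ iB)]; left.
    move: uB vB; rewrite eB !in_botB; case: u v => u [] v //= uC vC.
    apply: (stack2 (u := inr u) (v := inr v) _ (bot_dgm D CT)); by rewrite in_botB.
  case: u v uB vB => u [] v uB vB.
  + exact: (stack1 _ Bw uB vB).
  + apply: connect_trans (step _ (notail _ vB)).2.
    exact: (stack1 _ Bw uB vB).
  + apply: connect_trans (step _ (notail _ uB)).1 _.
    exact: (stack1 _ Bw uB vB).
  + apply: connect_trans (step _ (notail _ uB)).1 _.
    apply: connect_trans (step _ (notail _ vB)).2.
    exact: (stack1 _ Bw uB vB).
Qed.

(** A block of [d1] contained in the top row never reaches the middle row, so its indicator function
    is constant along edges. *)
Lemma compose_top_block k (d1 d2 : diagram k) (C : {set 'I_k}) :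
  trivIset d1 -> topB C \in d1 -> C != set0 -> topB C \in compose d1 d2.
Proof.
move=> td Cd /set0Pn[i iC]; apply/imsetP; exists (inl i) => //.
apply/setP => v; rewrite inE in_topB; apply/idP/idP.
  case: v => // j jC; apply: (stack1 (u := inl i) (v := inl j) _ Cd); by rewrite in_topB.
pose f (x : W k) := (x.1 == lev0) && (x.2 \in C).
have f1 u : f (emb1 u) = (u \in topB C) by rewrite in_topB; case: u.
have f2 u : f (emb2 u) = false by case: u.
move=> /(@connect_invariant _ _ _ f) h.
have : f (embO (inl i)) = f (embO v).
  apply: h => x y /stackrelP[[B [a [b [Bd aB bB -> ->]]]]|[B [a [b [Bd aB bB -> ->]]]]];
    last by rewrite !f2.
  rewrite !f1; apply/idP/idP => h.
    by rewrite -(def_pblock td Cd h) (def_pblock td Bd aB).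
  by rewrite -(def_pblock td Cd h) (def_pblock td Bd bB).
by rewrite /f /= iC; case: v {h} => j //= <-.
Qed.

Lemma transp_dgm k (D : {set 'I_k}) (T : {set {set 'I_k}}) : transp (dgm D T) = dgm D T.
Proof.
have swK : involutive (@swapV k) by case.
have sw_in B v : (v \in (@swapV k) @: B) = (swapV v \in B).
  apply/imsetP/idP => [[u uB ->]|vB]; first by rewrite swK.
  by exists (swapV v); rewrite ?swK.
have sw1 i : (@swapV k) @: [set inl i; inr i] = [set inl i; inr i].
  by apply/setP => v; rewrite sw_in !in_through; case: v.
have sw2 C : (@swapV k) @: topB C = botB C.
  by apply/setP => v; rewrite sw_in in_topB in_botB; case: v.
have sw3 C : (@swapV k) @: botB C = topB C.
  by apply/setP => v; rewrite sw_in in_topB in_botB; case: v.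
apply/setP => B; apply/imsetP/dgmP => [[B' /dgmP[][c cT ->] ->]|[][c cT ->]].
- by apply: Or31; exists c; rewrite // sw1.
- by apply: Or33; exists c; rewrite // sw2.
- by apply: Or32; exists c; rewrite // sw3.
- by exists [set inl c; inr c]; rewrite ?sw1 ?through_dgm.
- by exists (botB c); rewrite ?sw3 ?bot_dgm.
- by exists (topB c); rewrite ?sw2 ?top_dgm.
Qed.

Lemma nprop_dgm k (D : {set 'I_k}) (T : {set {set 'I_k}}) : nprop (dgm D T) = #|D|.
Proof.
have inj : injective (fun i : 'I_k => [set (inl i : V k); inr i]).
  by move=> i j /setP/(_ (inl i)); rewrite !in_through eqxx => /esym/eqP.
rewrite /nprop -(card_imset _ inj); apply: eq_card => B.
rewrite inE; apply/andP/imsetP => [[/dgmP[][c cT ->]]|[i iD ->]].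
- by exists c.
- by case/andP => _ /existsP[j]; rewrite in_topB.
- by case/andP => /existsP[j]; rewrite in_botB.
- split; first exact: through_dgm.
  by apply/andP; split; apply/existsP; exists i; rewrite in_through.
Qed.

Lemma topB_in_dgm k (D : {set 'I_k}) (T : {set {set 'I_k}}) C : C != set0 ->
  (topB C \in dgm D T) = (C \in T).
Proof.
move=> /set0Pn[i iC]; apply/dgmP/idP => [[[j jD]|[B BT /topB_inj->]|[B BT]]|CT] //.
- by move/setP/(_ (inr j)); rewrite in_through in_topB eqxx.
- by move/setP/(_ (inl i)); rewrite in_topB in_botB iC.
- by apply: Or32; exists C.
Qed.

Lemma through_in_dgm k (D : {set 'I_k}) (T : {set {set 'I_k}}) i :
  ([set (inl i : V k); inr i] \in dgm D T) = (i \in D).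
Proof.
apply/idP/idP => [/dgmP[[j jD]|[B BT]|[B BT]]|]; last exact: through_dgm.
- by move/setP/(_ (inl i)); rewrite !in_through eqxx => /esym/eqP->.
- by move/setP/(_ (inr i)); rewrite in_through in_topB eqxx.
- by move/setP/(_ (inl i)); rewrite in_through in_botB eqxx.
Qed.

(** Each [C] in [T] closes up in the middle row: the bottom block of the left factor meets the
    identical top block of [w] and nothing else. Every other middle point lies on a strand and so
    reaches the top row. Hence the count does not depend on [w]. *)
Lemma ell_dgm k (D : {set 'I_k}) (T : {set {set 'I_k}}) (w : diagram k) :
  partition T (~: D) -> partition w [set: V k] -> (forall C, C \in T -> topB C \in w) ->
  ell (dgm D T) w = #|T|.
Proof.
move=> pT pw Tw; have /partition_blockP[T0 cov triv] := pT.
have /and3P[/eqP cw tw w0] := pw.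
have pd := dgm_partition pT; have /and3P[_ td _] := pd.
pose mid C := [set ((lev1, i) : W k) | i in C : {set 'I_k}].
have in_mid C x : (x \in mid C) = (x.1 == lev1) && (x.2 \in C).
  case: x => l i; apply/imsetP/andP => [[j jC [-> ->]]|[/eqP/=-> iC]] //.
  by exists i.
have class C i : C \in T -> i \in C ->
    [set y | connect (stackrel (dgm D T) w) (lev1, i) y] = mid C.
  move=> CT iC; apply/setP => x; rewrite inE; apply/idP/idP; last first.
    case/imsetP => j jC ->.
    by apply: (stack2 (u := inl i) (v := inl j) _ (Tw _ CT)); rewrite in_topB.
  have e1 u : (emb1 u \in mid C) = (u \in botB C) by rewrite in_mid in_botB; case: u.
  have e2 u : (emb2 u \in mid C) = (u \in topB C) by rewrite in_mid in_topB; case: u.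
  move=> /(@connect_invariant _ _ _ (fun x => x \in mid C)) <-; first by rewrite in_mid /= iC.
  move=> {}x y /stackrelP[[B [a [b [Bd aB bB -> ->]]]]|[B [a [b [Bd aB bB -> ->]]]]].
    rewrite !e1; have Cd := bot_dgm D CT; apply/idP/idP => h.
      by rewrite -(def_pblock td Cd h) (def_pblock td Bd aB).
    by rewrite -(def_pblock td Cd h) (def_pblock td Bd bB).
  rewrite !e2; have Cd := Tw _ CT; apply/idP/idP => h.
    by rewrite -(def_pblock tw Cd h) (def_pblock tw Bd aB).
  by rewrite -(def_pblock tw Cd h) (def_pblock tw Bd bB).
have mid_inj : injective mid.
  by move=> B C /setP e; apply/setP => i; have := e (lev1, i); rewrite !in_mid.
rewrite /ell -(card_imset _ mid_inj); apply: eq_card => X.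
apply/imsetP/imsetP => [[[l i]]|[C CT ->]].
  rewrite inE /= => /andP[/eqP-> /forallP h] ->.
  have iD : i \in ~: D.
    rewrite in_setC; apply/negP => iD; suff con : connect (stackrel (dgm D T) w) (lev1, i) (lev0, i).
      by have := h (lev0, i); rewrite con.
    by apply: (stack1 (u := inr i) (v := inl i) _ (through_dgm T iD)); rewrite in_through.
  by have [C CT iC] := (cov i).1 iD; exists C; rewrite // (class C).
have /set0Pn[i iC] : C != set0 by apply: contraNneq T0 => <-.
exists (lev1, i); last by rewrite (class C).
rewrite inE /=; apply/forallP => y; apply/implyP => h.
have : y \in mid C by rewrite -(class C i) // inE.
by rewrite in_mid => /andP[].
Qed.

Lemma stackrel_sym k (d1 d2 : diagram k) : connect_sym (stackrel d1 d2).
Proof.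
apply: sym_connect_sym => x y; apply/stackrelP/stackrelP.
  by case=> [[B [a [b [? ? ? ? ?]]]]|[B [a [b [? ? ? ? ?]]]]]; [left|right]; exists B, b, a.
by case=> [[B [a [b [? ? ? ? ?]]]]|[B [a [b [? ? ? ? ?]]]]]; [left|right]; exists B, b, a.
Qed.

Lemma compose_trivIset k (d1 d2 : diagram k) : trivIset (compose d1 d2).
Proof.
apply/trivIsetP => B C /imsetP[u _ ->] /imsetP[v _ ->].
apply: contra_neqT => /pred0Pn[x]; rewrite /= !inE => /andP[ux vx].
apply/setP => y; rewrite !inE.
by rewrite (same_connect (@stackrel_sym _ _ _) ux) (same_connect (@stackrel_sym _ _ _) vx).
Qed.

(** The set [T] records the top and the bottom blocks at once, so one inclusion controls both the
    left factor and its reflection on the right. *)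
Lemma dgm_fixedE k (H D : {set 'I_k}) U T :
  partition U (~: H) -> partition T (~: D) ->
  (compose (compose (dgm H U) (dgm D T)) (transp (dgm H U)) == dgm D T) = (U \subset T).
Proof.
move=> pU pT; have pw := dgm_partition pT; have pd := dgm_partition pU.
have /and3P[_ tU U0] := pU.
apply/eqP/subsetP => [e C CU|sUT]; last first.
  rewrite transp_dgm compose_dgml // => [|C /sUT]; last exact: top_dgm.
  by apply: compose_dgmr => // C /sUT; apply: bot_dgm.
have C0 : C != set0 by apply: contraNneq U0 => <-.
rewrite -(topB_in_dgm D T C0) -e; apply: compose_top_block => //; first exact: compose_trivIset.
apply: compose_top_block => //; last exact: top_dgm.
by case/and3P: pd.
Qed.

(** * Symmetric diagrams under the three block conditions *)

Lemma topbot1 k (i : 'I_k) : topB [set i] :|: botB [set i] = [set (inl i : V k); inr i].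
Proof.
by apply/setP => v; rewrite in_setU in_topB in_botB in_through; case: v => j; rewrite !inE ?orbF.
Qed.

Lemma symm_mdiag_dgm k (D : {set 'I_k}) (T : {set {set 'I_k}}) :
  partition T (~: D) -> symm_mdiag #|D| (dgm D T).
Proof.
move=> /partition_blockP[T0 cov triv].
have notD C i : C \in T -> i \in C -> i \notin D.
  by move=> CT iC; rewrite -in_setC; apply/cov; exists C.
have TD : (set1 @: D :|: T) :\: set1 @: D = T.
  apply/setP => C; rewrite !inE; case CT: (C \in T); rewrite ?orbF ?andNb // orbT andbT.
  by apply/imsetP => -[i iD eC]; have := notD C i CT; rewrite eC inE eqxx iD => /(_ isT).
apply/existsP; exists (set1 @: D :|: T); apply/existsP; exists (set1 @: D).
apply/and4P; split.
- apply/partition_blockP; split.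
  + rewrite in_setU negb_or T0 andbT; apply/imsetP => -[i _ /setP/(_ i)].
    by rewrite !inE eqxx.
  + move=> i; split=> // _; have [iD|] := boolP (i \in D).
      by exists [set i]; rewrite !inE // imset_f.
    by rewrite -in_setC => /cov[C CT iC]; exists C; rewrite // in_setU CT orbT.
  + move=> B C x /setUP[/imsetP[b bD ->]|BT] /setUP[/imsetP[c cD ->]|CT].
    * by move=> /set1P <- /set1P <-.
    * by move=> /set1P -> /(notD _ _ CT); rewrite bD.
    * by move=> /(notD _ _ BT) h /set1P e; rewrite e cD in h.
    * exact: triv.
- exact: subsetUl.
- by rewrite (card_imset _ set1_inj).
- rewrite TD; apply/eqP; congr (_ :|: _ :|: _).
  by rewrite -imset_comp; apply: eq_imset => i /=; rewrite topbot1.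
Qed.

Lemma card_topbot k (C : {set 'I_k}) : #|topB C :|: botB C| = 2 * #|C|.
Proof.
rewrite cardsU /topB /botB !card_imset; try by move=> ? ? [].
rewrite (_ : _ :&: _ = set0) ?cards0 ?subn0 ?mul2n ?addnn //.
by apply/setP => v; rewrite !inE in_topB in_botB; case: v => i; rewrite ?andbF.
Qed.

Lemma card_topB k (C : {set 'I_k}) : #|topB C| = #|C|.
Proof. by rewrite /topB card_imset // => ? ? []. Qed.

Lemma card_botB k (C : {set 'I_k}) : #|botB C| = #|C|.
Proof. by rewrite /botB card_imset // => ? ? []. Qed.

Lemma blockcond_through A k (w : diagram k) (C : {set 'I_k}) :
  blockcond A w -> topB C :|: botB C \in w -> #|C| <= 1.
Proof.
case: A => /forall_inP h /h; rewrite ?card_topbot; [lia|lia|].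
case/andP => + _; congr (_ <= _); apply: eq_card => i.
by rewrite !inE in_topB in_botB orbF.
Qed.

(** For [PRook] the bound is really 1; the common value 2 lets all three algebras share the encoding
    by involutions. *)
Lemma blockcond_top A k (w : diagram k) (C : {set 'I_k}) :
  blockcond A w -> topB C \in w -> #|C| <= 2.
Proof.
case: A => /forall_inP h /h; rewrite ?card_topB; [lia|lia|].
case/andP => + _ => le1; apply: leq_trans (leq_trans le1 _) => //.
by apply: subset_leq_card; apply/subsetP => i; rewrite !inE in_topB.
Qed.

(** The block conditions force each distinguished set [B] to be a single point, so that [B] and its
    copy [B'] form a vertical strand. This is why [dgm] covers every basis element of the three
    modules. *)
Lemma symm_mdiag_inv A k m (w : diagram k) : symm_mdiag m w -> blockcond A w ->
  exists D T, [/\ partition T (~: D), #|D| = m, w = dgm D T & forall C, C \in T -> #|C| <= 2].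
Proof.
move=> /existsP[Q /existsP[D' /and4P[/partition_blockP[Q0 cov triv] /subsetP sD /eqP cD /eqP ew]]] hb.
have single C : C \in D' -> exists i, C = [set i].
  move=> CD; apply/cards1P; rewrite eqn_leq card_gt0 (blockcond_through hb).
    by apply: contraNneq Q0 => <-; apply: sD.
  by rewrite ew !in_setU (imset_f (fun B => topB B :|: botB B)).
pose D := [set i | [set i] \in D'].
have eD : D' = set1 @: D.
  apply/setP => C; apply/idP/imsetP => [CD|[i]]; last by rewrite inE => ? ->.
  by have [i e] := single _ CD; exists i; rewrite // inE -e.
exists D, (Q :\: D'); split.
- apply/partition_blockP; split.
  + by rewrite inE (negbTE Q0) andbF.
  + move=> i; rewrite !inE; split=> [niD|[C /setDP[CQ CD] iC]].
      have [C CQ iC] := (cov i).1 (in_setT i); exists C => //; rewrite inE CQ andbT.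
      by apply: contra niD => CD; have [j e] := single _ CD; move: iC CD; rewrite e => /set1P->.
    apply: contra CD => iD; rewrite (triv C [set i] i) //; first exact: sD.
    exact: set11.
  + by move=> B C x /setDP[BQ _] /setDP[CQ _]; apply: triv.
- by rewrite -cD eD (card_imset _ set1_inj).
- rewrite ew /dgm; congr (_ :|: _ :|: _).
  by rewrite eD -imset_comp; apply: eq_imset => i /=; rewrite topbot1.
- by move=> C CT; apply: (blockcond_top hb); rewrite ew !in_setU (imset_f (@topB k)) ?orbT.
Qed.

(** * Blocks of an involution, planarity and block sizes *)

(** At a fixed point the pair collapses to a singleton, so arcs and isolated points need no separate
    treatment. *)
Definition arcs k (p : 'I_k -> 'I_k) (D : {set 'I_k}) : {set {set 'I_k}} :=
  [set [set i; p i] | i in ~: D].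

Lemma mem_arcs k (p : 'I_k -> 'I_k) (D : {set 'I_k}) i :
  i \notin D -> [set i; p i] \in arcs p D.
Proof. by move=> niD; apply/imsetP; exists i; rewrite // inE. Qed.

Lemma arcs_partition k (p : 'I_k -> 'I_k) (D : {set 'I_k}) :
  involutive p -> {in D, forall i, p i = i} -> partition (arcs p D) (~: D).
Proof.
move=> pK pD; apply/partition_blockP; split.
- by apply/imsetP => -[i _ /setP/(_ i)]; rewrite !inE eqxx.
- move=> i; split=> [iD|[B /imsetP[j jD ->]]].
    by exists [set i; p i]; rewrite ?mem_arcs -?in_setC // !inE eqxx.
  case/set2P => -> //; move: jD; rewrite !inE; apply: contra => h.
  by rewrite -(pK j) (pD _ h).
- move=> B C x /imsetP[i _ ->] /imsetP[j _ ->].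
  have block y : x \in [set y; p y] -> [set y; p y] = [set x; p x].
    by case/set2P => ->; rewrite ?pK // setUC.
  by move=> /block-> /block->.
Qed.

Lemma arcs_exist k (D : {set 'I_k}) (T : {set {set 'I_k}}) :
  partition T (~: D) -> (forall C, C \in T -> #|C| <= 2) ->
  exists p : {ffun 'I_k -> 'I_k},
    [/\ involutive p, {in D, forall i, p i = i} & T = arcs p D].
Proof.
move=> pT sz; have /and3P[/eqP cT tT T0] := pT.
(* The default [i] applies when the block has no second element, and makes [p] fix isolated
   points. *)
pose p := [ffun i => if i \in D then i else odflt i [pick j | (j \in pblock T i) && (j != i)]].
have pD : {in D, forall i, p i = i} by move=> i iD; rewrite ffunE iD.
have blockE i : i \notin D -> pblock T i = [set i; p i].
  move=> niD; have iT : i \in cover T by rewrite cT inE.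
  rewrite ffunE (negbTE niD); case: pickP => [j /andP[jT ne]|none] /=; last first.
    apply/setP => j; rewrite !inE orbb; have [->|ne] := eqVneq j i.
      by rewrite mem_pblock.
    by have := none j; rewrite ne andbT.
  apply/esym/eqP; rewrite eqEcard cards2 eq_sym ne sz ?pblock_mem // andbT.
  by apply/subsetP => x /set2P[]->; rewrite ?mem_pblock.
have pK : involutive p.
  move=> i; have [iD|niD] := boolP (i \in D); first by rewrite !pD.
  have iT : i \in cover T by rewrite cT inE.
  have pi_block : p i \in pblock T i by rewrite blockE // !inE eqxx orbT.
  have pnD : p i \notin D.
    by rewrite -in_setC -cT; apply/bigcupP; exists (pblock T i); rewrite ?pblock_mem.
  have := blockE _ pnD; rewrite (def_pblock tT (pblock_mem iT) pi_block) blockE // => e.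
  have : i \in [set p i; p (p i)] by rewrite -e !inE eqxx.
  case/set2P => // ei; by rewrite -!ei.
exists p; split=> //; apply/setP => C; apply/idP/imsetP => [CT|[i]]; last first.
  rewrite inE => niD ->; rewrite -blockE // pblock_mem // cT inE //.
have /set0Pn[i iC] : C != set0 by apply: contraNneq T0 => <-.
have niD : i \in ~: D by rewrite -cT; apply/bigcupP; exists C.
by exists i; rewrite // -blockE -?in_setC // (def_pblock tT CT).
Qed.

Lemma in_arcs k (p : 'I_k -> 'I_k) (D : {set 'I_k}) i j :
  involutive p -> {in D, forall i, p i = i} ->
  ([set i; j] \in arcs p D) = (i \notin D) && (j == p i).
Proof.
move=> pK pD; have /partition_blockP[_ cov triv] := arcs_partition pK pD.
apply/idP/andP => [h|[niD /eqP->]]; last exact: mem_arcs.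
have niD : i \in ~: D by apply/cov; exists [set i; j]; rewrite // !inE eqxx.
split; first by rewrite -in_setC.
have e : [set i; j] = [set i; p i].
  by apply: (triv _ _ i) => //; rewrite ?mem_arcs -?in_setC // !inE eqxx.
have : p i \in [set i; j] by rewrite e !inE eqxx orbT.
have : j \in [set i; p i] by rewrite -e !inE eqxx orbT.
by case/set2P => -> // /set2P[] ->.
Qed.

Lemma planarP k (d : diagram k) :
  reflect (forall B C a b c e, B \in d -> C \in d -> B != C ->
             a \in B -> c \in B -> b \in C -> e \in C ->
             pos a < pos b -> pos b < pos c -> pos c < pos e -> False) (planar d).
Proof.
apply: (iffP forall_inP) => [h B C a b c e Bd Cd ne aB cB bC eC ab bc ce|h B Bd].
  have /forall_inP/(_ C Cd) := h B Bd; rewrite ne /= => /negP; apply.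
  apply/exists_inP; exists a => //; apply/exists_inP; exists c => //.
  apply/exists_inP; exists b => //; apply/exists_inP; exists e => //.
  by rewrite ab bc ce.
apply/forall_inP => C Cd; apply/implyP => ne; apply/negP.
move=> /exists_inP[a aB /exists_inP[c cB /exists_inP[b bC /exists_inP[e eC]]]].
by move=> /andP[/andP[ab bc] ce]; apply: (h B C a b c e).
Qed.

(** In the boundary order all bottom vertices follow all top vertices, in reverse. Strands therefore
    never cross each other, a strand crosses a pair exactly when it lies under the arc, and the
    bottom row only repeats the conditions of the top row. *)
Lemma planar_arcsP k (p : 'I_k -> 'I_k) (D : {set 'I_k}) :
  involutive p -> {in D, forall i, p i = i} ->
  reflect ((forall a b : 'I_k, a < b -> b < p a -> p a < p b -> False) /\
           (forall a d : 'I_k, d \in D -> a < d -> d < p a -> False))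
          (planar (dgm D (arcs p D))).
Proof.
move=> pK pD.
have notD (a : 'I_k) : a < p a -> a \notin D.
  by apply: contraTN => /pD->; rewrite ltnn.
have arcT := @mem_arcs k p D.
have other i (x y : 'I_k) : x \in [set i; p i] -> y \in [set i; p i] ->
    (x : nat) != y -> y = p x.
  by case/set2P => -> /set2P[] ->; rewrite ?pK ?eqxx.
apply: (iffP (planarP _)) => [h|[nc nest]].
  split=> [a b ab bp pp|a d dD ad dp].
    have aD := notD a (ltn_trans ab bp); have bD := notD b (ltn_trans bp pp).
    apply: (h (topB [set a; p a]) (topB [set b; p b]) (inl a) (inl b) (inl (p a)) (inl (p b)));
      rewrite ?top_dgm ?arcT ?in_topB ?inE ?eqxx ?orbT //.
    apply/eqP => /topB_inj/setP/(_ b); rewrite !inE eqxx /=.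
    by move=> /orP[]/eqP e; move: ab bp; rewrite e ltnn.
  have aD := notD a (ltn_trans ad dp).
  apply: (h (topB [set a; p a]) [set inl d; inr d] (inl a) (inl d) (inl (p a)) (inr d));
    rewrite ?top_dgm ?through_dgm ?arcT ?in_topB ?in_through ?inE ?eqxx ?orbT //.
    by apply/eqP => /setP/(_ (inr d)); rewrite in_topB in_through eqxx.
  by have := ltn_ord (p a); have := ltn_ord d; rewrite /=; lia.
move=> B C a b c e /dgmP[[i iD ->]|[S /imsetP[i iD ->] ->]|[S /imsetP[i iD ->] ->]]
  /dgmP[[j jD ->]|[S' /imsetP[j jD ->] ->]|[S' /imsetP[j jD ->] ->]] _.
(* Nine pairs of block types; after arithmetic four interleavings remain: a strand in a bottom arc,
   a strand in a top arc, two top arcs, two bottom arcs. In the bottom row the order is reversed, so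
   the ends of the arcs are exchanged. *)
all: rewrite ?in_through ?in_topB ?in_botB.
all: case: a c b e => a [] c [] b [] e //=.
all: have := ltn_ord a; have := ltn_ord b; have := ltn_ord c; have := ltn_ord e.
all: move=> ? ? ? ?.
all: try by (do ?move=> /eqP ?); subst; lia.
all: try by move=> *; lia.
- move=> /eqP ea /eqP ec hb he ? ? ?; have eb : b = p e by apply: (other j) => //; lia.
  by rewrite -ec in iD; apply: (nest e c iD); rewrite -?eb; lia.
- move=> ha hc /eqP ? /eqP ? ? ? ?; subst; apply: (nest a j) => //.
  by have <- : c = p a by apply: (other i) => //; lia.
- move=> ha hc hb he ? ? ?; have ec : c = p a by apply: (other i) => //; lia.
  have ee : e = p b by apply: (other j) => //; lia.
  by subst; apply: (nc a b).
- move=> ha hc hb he ? ? ?; have ea : a = p c by apply: (other i) => //; lia.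
  have eb : b = p e by apply: (other j) => //; lia.
  by subst; apply: (nc e c); lia.
Qed.

Lemma blockcond_arcsP A k (p : 'I_k -> 'I_k) (D : {set 'I_k}) :
  {in D, forall i, p i = i} ->
  reflect (match A with
           | TL => forall i, p i = i -> i \in D
           | Motz => True
           | PRook => forall i, p i = i
           end) (blockcond A (dgm D (arcs p D))).
Proof.
move=> pD.
have card_through i : #|[set (inl i : V k); inr i]| = 2 by rewrite cards2.
have cardP B : B \in dgm D (arcs p D) -> #|B| = 2 \/
    exists2 i, i \notin D & #|B| = (p i != i).+1.
  case/dgmP => [[i _ ->]|[C /imsetP[i iD ->] ->]|[C /imsetP[i iD ->] ->]]; first by left.
    by right; exists i; rewrite ?card_topB ?cards2 1?eq_sym // -in_setC.
  by right; exists i; rewrite ?card_botB ?cards2 1?eq_sym // -in_setC.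
have arcT := @mem_arcs k p D.
case: A; apply: (iffP forall_inP) => //.
- move=> h i pi; apply: contraT => /arcT/(top_dgm D)/h.
  by rewrite card_topB cards2 pi eqxx.
- move=> h B /cardP[->//|[i niD ->]].
  by have -> : p i != i by apply: contraNneq niD; apply: h.
- by move=> _ B /cardP[->//|[i niD ->]]; case: (p i != i).
- move=> h i; have [/pD//|niD] := boolP (i \in D).
  have /andP[+ _] := h _ (top_dgm D (arcT _ niD)).
  rewrite (_ : [set _ | _] = [set i; p i]); last by apply/setP => j; rewrite inE in_topB.
  by rewrite cards2; case: eqP.
- move=> h B /dgmP[[i _ ->]|[C /imsetP[i iD ->] ->]|[C /imsetP[i iD ->] ->]].
  + rewrite (_ : [set _ | _] = [set i]); last by apply/setP => j; rewrite inE in_through inE.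
    rewrite (_ : [set _ | _] = [set i]); last by apply/setP => j; rewrite inE in_through inE.
    by rewrite cards1.
  + rewrite (_ : [set _ | _] = [set i]); last by apply/setP => j; rewrite inE in_topB !inE h orbb.
    rewrite (_ : [set _ | _] = set0); last by apply/setP => j; rewrite !inE in_topB.
    by rewrite cards1 cards0.
  + rewrite (_ : [set _ | _] = set0); last by apply/setP => j; rewrite !inE in_botB.
    rewrite (_ : [set _ | _] = [set i]); last by apply/setP => j; rewrite inE in_botB !inE h orbb.
    by rewrite cards1 cards0.
Qed.

(** * The trace as a number of half-diagrams *)

(** Supplies the block condition at the points from [r] on, about which [half_alg] is silent. *)
Definition tail_spec (A : Alg) k (sigma : 'I_k -> 'I_k) (r : nat) : Prop :=
  match A with
  | TL => forall i : 'I_k, r <= i -> sigma i <> i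
  | Motz => True
  | PRook => forall i, sigma i = i
  end.

Definition head_points k (r : nat) : {set 'I_k} := [set i : 'I_k | i < r].

Definition half_to_dgm k (x : half_data k) : diagram k := dgm x.2 (arcs x.1 x.2).

(** Being fixed by [d] means containing the pairs of [sigma] from [r] on. In terms of the involution
    this says that it agrees with [sigma] there and that all defects lie below [r], which are the
    tail conditions of a half-diagram. *)
Lemma fixed_basisE A k (sigma : 'I_k -> 'I_k) r m :
  involutive sigma -> (forall i : 'I_k, i < r -> sigma i = i) -> tail_spec A sigma r ->
  let d := dgm (head_points k r) (arcs sigma (head_points k r)) in
  [set w in modBasis A k m | compose (compose d w) (transp d) == w] =
  @half_to_dgm k @: half_diagrams A sigma r m.
Proof.
move=> sK sfix hA d.
have sH : {in head_points k r, forall i, sigma i = i} by move=> i; rewrite inE; apply: sfix.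
have pU := arcs_partition sK sH.
apply/setP => w; apply/idP/imsetP.
  rewrite !inE => /andP[/andP[sym /and3P[_ plw bw]] fixw].
  have [D [T [pT cD ew sz]]] := symm_mdiag_inv sym bw.
  have [p [pK pD eT]] := arcs_exist pT sz.
  exists (p, D); last by rewrite /half_to_dgm /= -eT.
  move: fixw; rewrite ew dgm_fixedE // => /subsetP sub.
  have tail (i : 'I_k) : r <= i -> (i \notin D) /\ p i = sigma i.
    move=> le_i; have : [set i; sigma i] \in T.
      by apply: sub; rewrite mem_arcs // !inE -leqNgt.
    by rewrite eT in_arcs // => /andP[-> /eqP->].
  move: plw bw; rewrite ew eT => /(planar_arcsP pK pD)[nc nest] /(blockcond_arcsP _ pD) hb.
  apply/half_diagramsP; split=> //=.
  - move=> i iD; split; first exact: pD.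
    by rewrite ltnNge; apply/negP => /tail[]; rewrite iD.
  - by move=> i /tail[].
  - by case: A hb {hA sym} => // h i _; apply: h.
move=> [[p D] /half_diagramsP[/= pK hD pt nc nest cD hb] ->]; rewrite /half_to_dgm /=.
have pD : {in D, forall i, p i = i} by move=> i /hD[].
have pT := arcs_partition pK pD.
rewrite !inE -cD symm_mdiag_dgm //= dgm_fixedE //.
apply/andP; split; last first.
  apply/subsetP => B /imsetP[i]; rewrite !inE -leqNgt => le_i ->.
  rewrite in_arcs // pt // eqxx andbT; apply/negP => /hD[_].
  by rewrite ltnNge le_i.
apply/and3P; split; first exact: dgm_partition.
  by apply/planar_arcsP.
apply/blockcond_arcsP => //; case: A hA hb => //= h1 h2 i.
  by have [/h2//|/[dup] le_i /h1 ne] := ltnP i r; rewrite pt.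
by have [/h2//|/pt->] := ltnP i r.
Qed.

Lemma half_to_dgm_inj A k (sigma : 'I_k -> 'I_k) r m :
  {in half_diagrams A sigma r m &, injective (@half_to_dgm k)}.
Proof.
move=> [p D] [p' D'] /half_diagramsP[/= pK hD _ _ _ _ _] /half_diagramsP[/= p'K hD' _ _ _ _ _] e.
have eD : D = D'.
  by apply/setP => i; rewrite -(through_in_dgm D (arcs p D)) -(through_in_dgm D' (arcs p' D')) [dgm _ _]e.
congr pair => //; apply/ffunP => i; have [iD|niD] := boolP (i \in D).
  by rewrite (hD i iD).1 (hD' i _).1 // -eD.
have pD : {in D, forall i, p i = i} by move=> j /hD[].
have p'D : {in D', forall i, p' i = i} by move=> j /hD'[].
have : topB [set i; p i] \in half_to_dgm (p, D) by rewrite top_dgm ?in_arcs ?niD ?eqxx.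
rewrite e topB_in_dgm; last by apply/set0Pn; exists i; rewrite !inE eqxx.
by rewrite in_arcs // => /andP[_ /eqP].
Qed.

(** Once the product equals [w], it has [m] propagating blocks automatically, so every fixed basis
    element contributes the same power of [n]. *)
Lemma trD_dgm n A k (sigma : 'I_k -> 'I_k) r m :
  involutive sigma -> (forall i : 'I_k, i < r -> sigma i = i) -> tail_spec A sigma r ->
  trD n A m (dgm (head_points k r) (arcs sigma (head_points k r))) =
  ((n%:R : rat) ^+ #|arcs sigma (head_points k r)| * #|half_diagrams A sigma r m|%:R)%R.
Proof.
move=> sK sfix hA; rewrite -(card_in_imset (@half_to_dgm_inj A k sigma r m)).
rewrite -(fixed_basisE m sK sfix hA) /trD; set d := dgm _ _.
have pU : partition (arcs sigma (head_points k r)) (~: head_points k r).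
  by apply: arcs_partition => // i; rewrite inE; apply: sfix.
rewrite (eq_bigr (fun w => if compose (compose d w) (transp d) == w
   then (n%:R : rat) ^+ #|arcs sigma (head_points k r)| else 0)%R); last first.
  move=> w; rewrite inE => /andP[sym /and3P[pw _ bw]].
  have [D [T [pT cD ew sz]]] := symm_mdiag_inv sym bw.
  case: ifP => [/[dup] fixw /eqP->|]; last by rewrite mulr0.
  rewrite ew nprop_dgm cD eqxx mulr1 ell_dgm //; first exact: dgm_partition.
  by move: fixw; rewrite ew dgm_fixedE // => /subsetP sub C /sub; apply: top_dgm.
rewrite -big_mkcondr /= sumr_const -[LHS]mulr_natr; congr (_ * _%:R)%R.
by apply: eq_card => w; rewrite [RHS]inE.
Qed.

(** * The diagram underlying the tensor product of the identity with powers of [e] *)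

(* Index functions on [nat] rather than on ordinals let [castD] and [tensor]
   be followed without transporting anything. *)
Definition described k (d : diagram k) (q : nat -> nat) (P : pred nat) : Prop :=
  forall B, B \in d <->
    [\/ exists2 i : 'I_k, P i & B = [set (inl i : V k); inr i],
        exists i j : 'I_k, [/\ ~~ P i, j = q i :> nat & B = topB [set i; j]] |
        exists i j : 'I_k, [/\ ~~ P i, j = q i :> nat & B = botB [set i; j]]].

Lemma described_ext k (d : diagram k) q P q' P' :
  (forall i, i < k -> P i = P' i) -> (forall i, i < k -> ~~ P i -> q i = q' i) ->
  described d q P -> described d q' P'.
Proof.
move=> eP eq dd B; rewrite dd; split; case.
- by case=> i h ->; apply: Or31; exists i; rewrite // -eP.
- by case=> i [j [h e ->]]; apply: Or32; exists i, j; split; rewrite -?eP -?eq.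
- by case=> i [j [h e ->]]; apply: Or33; exists i, j; split; rewrite -?eP -?eq.
- by case=> i h ->; apply: Or31; exists i; rewrite // eP.
- by case=> i [j [h e ->]]; apply: Or32; exists i, j; split; rewrite ?eP ?eq // eP.
- by case=> i [j [h e ->]]; apply: Or33; exists i, j; split; rewrite ?eP ?eq // eP.
Qed.

Lemma described_cast a b (E : a = b) (d : diagram a) q P :
  described d q P -> described (castD E d) q P.
Proof.
case: b / E; suff -> : castD erefl d = d by [].
have castV_id : @castV a a erefl =1 id by case=> i /=; rewrite cast_ord_id.
rewrite /castD -[RHS]imset_id; apply: eq_imset => B.
by rewrite (eq_imset _ castV_id) imset_id.
Qed.

(** Alone, an index whose partner is out of range yields no block; after enlarging the diagram the
    same value could name a vertex of the right factor. The bound on [q1] excludes this. *)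
Lemma described_tensor a b (d1 : diagram a) (d2 : diagram b) q1 P1 q2 P2 :
  (forall i, i < a -> ~~ P1 i -> q1 i < a) ->
  described d1 q1 P1 -> described d2 q2 P2 ->
  described (tensor d1 d2) (fun i => if i < a then q1 i else a + q2 (i - a))
                           (fun i => if i < a then P1 i else P2 (i - a)).
Proof.
move=> bound dd1 dd2 B; rewrite /tensor.
have L1 (i : 'I_a) : (@liftL a b) @: [set inl i; inr i] = [set inl (lshift b i); inr (lshift b i)].
  by rewrite imsetU !imset_set1.
have L2 (i j : 'I_a) : (@liftL a b) @: topB [set i; j] = topB [set lshift b i; lshift b j].
  by rewrite /topB !imsetU !imset_set1.
have L3 (i j : 'I_a) : (@liftL a b) @: botB [set i; j] = botB [set lshift b i; lshift b j].
  by rewrite /botB !imsetU !imset_set1.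
have R1 (i : 'I_b) : (@liftR a b) @: [set inl i; inr i] = [set inl (rshift a i); inr (rshift a i)].
  by rewrite imsetU !imset_set1.
have R2 (i j : 'I_b) : (@liftR a b) @: topB [set i; j] = topB [set rshift a i; rshift a j].
  by rewrite /topB !imsetU !imset_set1.
have R3 (i j : 'I_b) : (@liftR a b) @: botB [set i; j] = botB [set rshift a i; rshift a j].
  by rewrite /botB !imsetU !imset_set1.
have ge (i : nat) : (a + i < a) = false by lia.
split.
  case/setUP => /imsetP[B']; rewrite ?dd1 ?dd2 => -[[i h ->]|[i [j [h e ->]]]|[i [j [h e ->]]]] ->.
  - by apply: Or31; exists (lshift b i); rewrite ?L1 //= ltn_ord.
  - by apply: Or32; exists (lshift b i), (lshift b j); rewrite L2 /= ltn_ord.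
  - by apply: Or33; exists (lshift b i), (lshift b j); rewrite L3 /= ltn_ord.
  - by apply: Or31; exists (rshift a i); rewrite ?R1 //= ge addKn.
  - by apply: Or32; exists (rshift a i), (rshift a j); rewrite R2 /= ge addKn e.
  - by apply: Or33; exists (rshift a i), (rshift a j); rewrite R3 /= ge addKn e.
case=> [[i + ->]|[i [j [+ + ->]]]|[i [j [+ + ->]]]].
- case: (split_ordP i) => i' -> /=; rewrite ?ltn_ord ?ge ?addKn => h; apply/setUP; [left|right].
    by apply/imsetP; exists [set inl i'; inr i']; rewrite ?L1 // dd1; apply: Or31; exists i'.
  by apply/imsetP; exists [set inl i'; inr i']; rewrite ?R1 // dd2; apply: Or31; exists i'.
- case: (split_ordP i) => i' -> /=; rewrite ?ltn_ord ?ge ?addKn => h;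
    case: (split_ordP j) => j' -> /= e.
  + apply/setUP; left; apply/imsetP; exists (topB [set i'; j']); rewrite ?L2 // dd1.
    by apply: Or32; exists i', j'.
  + by have := bound i' (ltn_ord i') h; rewrite -e ge.
  + by have := ltn_ord j'; rewrite e ge.
  + apply/setUP; right; apply/imsetP; exists (topB [set i'; j']); rewrite ?R2 // dd2.
    by apply: Or32; exists i', j'; split=> //; apply/eqP; rewrite -(eqn_add2l a) e.
- case: (split_ordP i) => i' -> /=; rewrite ?ltn_ord ?ge ?addKn => h;
    case: (split_ordP j) => j' -> /= e.
  + apply/setUP; left; apply/imsetP; exists (botB [set i'; j']); rewrite ?L3 // dd1.
    by apply: Or33; exists i', j'.
  + by have := bound i' (ltn_ord i') h; rewrite -e ge.
  + by have := ltn_ord j'; rewrite e ge.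
  + apply/setUP; right; apply/imsetP; exists (botB [set i'; j']); rewrite ?R3 // dd2.
    by apply: Or33; exists i', j'; split=> //; apply/eqP; rewrite -(eqn_add2l a) e.
Qed.

Lemma described_idD r q : described (idD r) q (fun i => i < r).
Proof.
move=> B; split=> [/imsetP[i _ ->]|]; first by apply: Or31; exists i => //=.
case=> [[i _ ->]|[i [j []]]|[i [j []]]]; rewrite ?ltn_ord //.
by apply/imsetP; exists i.
Qed.

Lemma described_emptyD q P : described emptyD q P.
Proof. by move=> B; rewrite inE; split=> // -[[[]]|[[]]|[[]]]. Qed.

(** With indices from 0 the arcs of [TL] join an even number to its successor. This rule commutes
    with the shift by [cA A], so a single function describes every tensor power. *)
Definition partner (A : Alg) (i : nat) : nat :=
  if A is TL then (if odd i then i.-1 else i.+1) else i.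

Definition gen_diagram (A : Alg) : diagram (cA A) :=
  match A return diagram (cA A) with TL => frakE | _ => frakP end.

Lemma described_gen A : described (gen_diagram A) (partner A) pred0.
Proof.
have described_frakP : described frakP id pred0.
  move=> B; split=> [/set2P[]->|[[]//|[i [j [_ _ ->]]]|[i [j [_ _ ->]]]]].
  - by apply: Or32; exists ord0, ord0; rewrite setUid /topB imset_set1.
  - by apply: Or33; exists ord0, ord0; rewrite setUid /botB imset_set1.
  - by rewrite !ord1 setUid /topB imset_set1 !inE eqxx.
  - by rewrite !ord1 setUid /botB imset_set1 !inE eqxx orbT.
case: A => //= B; split=> [/set2P[]->|[[]//|[i [j [_ e ->]]]|[i [j [_ e ->]]]]].
- by apply: Or32; exists ord0, ord_max; rewrite /topB imsetU !imset_set1.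
- by apply: Or33; exists ord0, ord_max; rewrite /botB imsetU !imset_set1.
- have -> : [set i; j] = [set ord0; ord_max].
    case: i j e => [[|[|//]] hi] [[|[|//]] hj] //= _; last rewrite setUC;
    by congr (_ :|: _); congr set1; apply: val_inj.
  by rewrite /topB imsetU !imset_set1 !inE eqxx.
- have -> : [set i; j] = [set ord0; ord_max].
    case: i j e => [[|[|//]] hi] [[|[|//]] hj] //= _; last rewrite setUC;
    by congr (_ :|: _); congr set1; apply: val_inj.
  by rewrite /botB imsetU !imset_set1 !inE eqxx orbT.
Qed.

Fixpoint powD c (d : diagram c) (s : nat) : diagram (s * c) :=
  match s return diagram (s * c) with
  | 0 => emptyD
  | s'.+1 => castD (esym (mulSnr s' c)) (tensor (powD d s') d)
  end.

Lemma powE_single c (x : rat) (d : diagram c) s :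
  powE [:: (x, d)] s = [:: (x ^+ s, powD d s)]%R.
Proof. by elim: s => [|s IH] //=; rewrite IH /= exprSr. Qed.

Lemma partnerK A : involutive (partner A).
Proof. by case: A => // i /=; case h : (odd i); case: ifP => h'; lia. Qed.

Lemma partner_lt A s i : i < s * cA A -> partner A i < s * cA A.
Proof. by case: A => //=; case: ifP; lia. Qed.

Lemma described_powD A s : described (powD (gen_diagram A) s) (partner A) pred0.
Proof.
elim: s => [|s IH]; first exact: described_emptyD.
apply: described_cast.
have := described_tensor (fun i lt _ => partner_lt lt) IH (@described_gen A).
apply: described_ext => i; first by rewrite if_same.
move=> _ _; case: ifP => // ge; case: A {IH} ge => /= ge; [|lia|lia].
have le : s * 2 <= i by lia.
by case: ifP => h1; case: ifP => h2; lia.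
Qed.

Lemma described_dgm k (d : diagram k) r q (sigma : 'I_k -> 'I_k) :
  described d q (fun i => i < r) -> (forall i : 'I_k, r <= i -> sigma i = q i :> nat) ->
  d = dgm (head_points k r) (arcs sigma (head_points k r)).
Proof.
move=> dd sq; apply/setP => B; apply/idP/dgmP; rewrite dd.
  case=> [[i h ->]|[i [j [h e ->]]]|[i [j [h e ->]]]].
  - by apply: Or31; exists i; rewrite ?inE.
  - apply: Or32; exists [set i; j] => //; rewrite -leqNgt in h.
    have -> : j = sigma i by apply: val_inj; rewrite /= sq.
    by rewrite mem_arcs // inE -leqNgt.
  - apply: Or33; exists [set i; j] => //; rewrite -leqNgt in h.
    have -> : j = sigma i by apply: val_inj; rewrite /= sq.
    by rewrite mem_arcs // inE -leqNgt.
case=> [[i h ->]|[C /imsetP[i + ->] ->]|[C /imsetP[i + ->] ->]].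
- by apply: Or31; exists i => //; rewrite inE in h.
- by rewrite !inE => h; apply: Or32; exists i, (sigma i); split; rewrite // sq // leqNgt.
- by rewrite !inE => h; apply: Or33; exists i, (sigma i); split; rewrite // sq // leqNgt.
Qed.

(** The default of [insubd] only makes the function total: when [r + s * cA A = k] the partner is
    always in range. *)
Definition tail_map (A : Alg) (k r : nat) (i : 'I_k) : 'I_k :=
  if i < r then i else insubd i (r + partner A (i - r)).

Lemma val_tail_map A k r s : r + s * cA A = k -> forall i : 'I_k,
  tail_map A r i = (if i < r then val i else r + partner A (i - r)) :> nat.
Proof.
move=> ek i; rewrite /tail_map; case: ifP => // ge.
rewrite val_insubd ifT //.
have lt : partner A (i - r) < s * cA A by apply: partner_lt; have := ltn_ord i; lia.
by rewrite -[ltnRHS]ek ltn_add2l.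
Qed.

Lemma tail_map_invol A k r s : r + s * cA A = k -> involutive (@tail_map A k r).
Proof.
move=> ek i; apply: val_inj; rewrite /= !(val_tail_map ek).
case lt_i : (i < r); first by rewrite /= lt_i (val_tail_map ek) lt_i.
rewrite ltnNge leq_addr /= addKn; have le_i : r <= i by lia.
by rewrite partnerK; lia.
Qed.

(** Arcs in the tail join neighbours, so no point lies strictly between their ends. *)
Lemma tail_map_nocross A k r s : r + s * cA A = k -> forall a b : 'I_k, a < b ->
  b < tail_map A r a -> tail_map A r a < tail_map A r b -> False.
Proof.
move=> ek a b ab; rewrite (val_tail_map ek) /= => lt_b _; move: lt_b.
have le_partner : partner A (a - r) <= (a - r).+1 by case: A {ek} => //=; case: ifP; lia.
by case: ifP; lia.
Qed.

Lemma tail_map_spec A k r s : r + s * cA A = k -> tail_spec A (@tail_map A k r) r.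
Proof.
move=> ek; have v := val_tail_map ek; case: A ek v => //= ek v i.
  move=> le_i /(congr1 (@nat_of_ord k)); rewrite v ltnNge le_i /=.
  by case: ifP => h; lia.
by apply: val_inj; rewrite /= v /=; case: ifP => h; lia.
Qed.

(** All blocks in the tail have size [cA A] and together they cover [s * cA A] points. This count is
    the exponent that cancels the normalisation of [e]. *)
Lemma card_tail_arcs A k r s : r + s * cA A = k ->
  #|arcs (@tail_map A k r) (head_points k r)| = s.
Proof.
move=> ek; have sK := tail_map_invol ek.
have sH : {in head_points k r, forall i, tail_map A r i = i}.
  by move=> i; rewrite inE /tail_map => ->.
have le_rk : r <= k by lia.
have card_head : #|head_points k r| = r.
  have inj : injective (widen_ord le_rk) by move=> i j [] /val_inj.
  rewrite -[RHS]card_ord -(card_imset _ inj).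
  apply: eq_card => i; rewrite inE; apply/idP/imsetP => [lt|[j _ ->]] /=; last exact: ltn_ord.
  by exists (Ordinal lt) => //; apply: val_inj.
have unif : {in arcs (@tail_map A k r) (head_points k r), forall C : {set 'I_k}, #|C| = cA A}.
  move=> C /imsetP[i]; rewrite !inE -leqNgt => le_i ->; rewrite cards2.
  have := tail_map_spec ek; case: A ek {sK sH} => /= ek sp.
  - by rewrite eq_sym; have /eqP -> := sp i le_i.
  - have -> // : tail_map Motz r i = i; last by rewrite eqxx.
    by apply: val_inj; rewrite /= (@val_tail_map Motz _ _ s ek) /=; case: ifP => h; lia.
  - by rewrite sp eqxx.
have := card_uniform_partition unif (arcs_partition sK sH).
have := cardsC (head_points k r); rewrite card_head card_ord.
by case: A ek {sK sH unif} => /=; lia.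
Qed.

Theorem mainTheorem15 (A : Alg) (n k m r s : nat)
  (hn : 2 * k <= n) (hlam : inLambda A k m) (hrs : r + s * cA A = k) :
  chi n A m (castE hrs (tensorE (idE r) (powE (genE n A) s)))
  = ((Fval A m r)%:~R : rat).
Proof.
have -> : genE n A = [:: ((n%:R : rat)^-1, gen_diagram A)]%R by case: A {hlam hrs}.
rewrite powE_single /chi big_seq1 /= mul1r.
have sfix (i : 'I_k) : i < r -> tail_map A r i = i by rewrite /tail_map => ->.
have dd : described (castD hrs (tensor (idD r) (powD (gen_diagram A) s)))
    (fun i => r + partner A (i - r)) (fun i => i < r).
  apply: described_cast.
  have := described_tensor (P1 := fun i => i < r) (q1 := id) _ (@described_idD r id) (@described_powD A s).
  move=> /(_ (fun _ lt _ => lt)); by apply: described_ext => i _; case: (i < r).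
rewrite (described_dgm (sigma := @tail_map A k r) dd); last first.
  by move=> i le_i; rewrite (val_tail_map hrs) ltnNge le_i.
rewrite trD_dgm //; [|exact: tail_map_invol hrs|exact: tail_map_spec hrs].
rewrite (card_tail_arcs hrs) (@card_half_diagrams A k _ r) //; last first.
- exact: tail_map_nocross hrs.
- exact: tail_map_invol hrs.
- by lia.
rewrite mulrA -exprMn -path_count_Fval; last first.
  by move=> eA; move: hlam (hrs); rewrite eA /inLambda /= => /andP[_ /eqP->]; lia.
(* For [n = 0] the inverse of [n] is 0 and nothing cancels; but then [2 * k <= n] gives [k = 0],
   hence [s = 0], and both powers are 1. *)
have [n0|n_gt0] := posnP n.
  have -> : s = 0 by clear dd; case: A hlam hrs sfix => /=; lia.
  by rewrite expr0 mul1r pmulrn.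
by rewrite mulVf ?expr1n ?mul1r ?pmulrn // pnatr_eq0 -lt0n.
Qed.
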